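(* Let $R$ be an overt commutative localic semiring and suppose that the suplattice $\mathscr{S}R$ of saturated opens of $R$ is dualisable in $\mathbf{Sup}$. Then the functor $\mathrm{OPAI}_R\colon \mathbf{Loc}^{\mathrm{op}} \to \mathbf{Set}$ is representable, with representing object (the locale whose frame of opens is) $\mathrm{Rad}(R)$ and universal element $(\rho\mathfrak{s} \otimes \kappa)\eta(\top) \in \mathrm{Rad}(R)\otimes\mathcal{O}R$, where $\rho\colon \mathrm{Idl}(R) \to \mathrm{Rad}(R)$ is the unit of the localic reflection and $\eta\colon \Omega \to \mathscr{M}R \otimes \mathscr{S}R$ is the unit of the duality between $\mathscr{S}R$ and $\mathscr{M}R$.
   Context: Everything is constructive (valid in any elementary topos with natural numbers object). $\Omega$ is the frame of truth values. $\mathbf{Sup}$ is the category of suplattices (posets with arbitrary joins, join-preserving maps), symmetric monoidal closed with tensor $\otimes$ (classifying maps preserving joins in each variable), unit $\Omega$, and internal hom $\hom(-,-)$ ordered pointwise; $\Delta\colon\Omega\otimes\Omega\cong\Omega$. Quantales are commutative monoids in $\mathbf{Sup}$; a quantale is two-sided if its unit is its top element. Frames are the two-sided quantales with idempotent multiplication, and form a reflective subcategory of two-sided quantales (the localic reflection; its unit is a quotient map). The coproduct of frames $\oplus$ has underlying suplattice $\otimes$. For a locale $X$, $\mathcal{O}X$ is its frame of opens, and for a locale map $f$, $f^*$ is the corresponding frame map. $X$ is overt if $\mathcal{O}X$ has a base of positive elements ($a$ is positive if $a\le\bigvee I$ implies $I$ is inhabited); equivalently, the locale map $X\to 1$ is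 open. A commutative localic semiring $R$ is a commutative semiring object (with $0$ and $1$) in locales; $\epsilon_0,\epsilon_1\colon\mathcal{O}R\to\Omega$ and $\mu_+,\mu_\times\colon\mathcal{O}R\to\mathcal{O}R\oplus\mathcal{O}R$ are the frame maps corresponding to zero, one, addition and multiplication; $\iota_1,\iota_2\colon\mathcal{O}R\to\mathcal{O}R\oplus\mathcal{O}R$ are the coproduct injections. $\mathrm{OPAI}_R(X)$ is the set of $u\in\mathcal{O}X\oplus\mathcal{O}R$ such that $(\mathcal{O}X\oplus\epsilon_0)(u)=0$, $(\mathcal{O}X\oplus\epsilon_1)(u)=1$, $(\mathcal{O}X\oplus\mu_+)(u)\le(\mathcal{O}X\oplus\iota_1)(u)\vee(\mathcal{O}X\oplus\iota_2)(u)$ and $(\mathcal{O}X\oplus\mu_\times)(u)=(\mathcal{O}X\oplus\iota_1)(u)\wedge(\mathcal{O}X\oplus\iota_2)(u)$; a locale map $f\colon Y\to X$ acts by $u\mapsto(f^*\oplus\mathcal{O}R)(u)$. Saturated opens: $\mathscr{S}R=\{s\in\mathcal{O}R\mid\mu_\times(s)\le\iota_1(s)\}$, a subframe with inclusion $\kappa\colon\mathscr{S}R\hookrightarrow\mathcal{O}R$. Overt weakly closed sublocales of $R$ are identified with elements of $\hom(\mathcal{O}R,\Omega)$. This suplattice is a quantale under $f\cdot g=\Delta(f\otimes g)\mu_\times$ with unit $\epsilon_1$, and also under $f+g=\Delta(f\otimes g)\mu_+$ with unit $0_+=\epsilon_0$. A monoid ideal is $I\in\hom(\mathcal{O}R,\Omega)$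 with $I=I\cdot\top$; the quantale of monoid ideals $\mathscr{M}R$ is the quotient of the multiplicative quantale $\hom(\mathcal{O}R,\Omega)$ by the nucleus $W\mapsto W\cdot\top$. An ideal is a monoid ideal $I$ with $0_+\le I$ and $I+I\le I$. $\mathrm{Idl}(R)$ is the quotient of the multiplicative quantale $\hom(\mathcal{O}R,\Omega)$ by the quantale congruence generated by $1=\top$, $0_+=0$ and $a+b\le a\vee b$ for all $a,b$; ideals are exactly the largest elements of the congruence classes. The quotient map factors through a quotient map $\mathfrak{s}\colon\mathscr{M}R\to\mathrm{Idl}(R)$. $\mathrm{Rad}(R)$ is the localic reflection of the two-sided quantale $\mathrm{Idl}(R)$. When $R$ is overt, $\mathscr{M}R\cong\hom(\mathscr{S}R,\Omega)$ via $h\mapsto h\kappa$; so if $\mathscr{S}R$ is dualisable, its dual is $\mathscr{M}R$, with counit $\mathscr{S}R\otimes\mathscr{M}R\to\Omega$ given by evaluation and unit $\eta$ determined by the triangle identities. *)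

(* Defs.v *)
From Corelib Require Import ssreflect.
From Stdlib Require Import FunctionalExtensionality PropExtensionality.
From Stdlib Require ClassicalFacts.

Set Implicit Arguments.
Unset Strict Implicit.
Unset Printing Implicit Defensive.

(** The ambient topos is that of types and functions, with [Prop] as the object
    of truth values; subobjects of [A] are predicates [A -> Prop].  Excluded
    middle and choice are not assumed. *)

Lemma proof_irrel (P : Prop) (p q : P) : p = q.
Proof.
exact: (ClassicalFacts.ext_prop_dep_proof_irrel_cic propositional_extensionality).
Qed.

Lemma sig_ext (A : Type) (P : A -> Prop) (x y : {a | P a}) :
  proj1_sig x = proj1_sig y -> x = y.
Proof.
case: x y => [x hx] [y hy] /= e; move: hy; case: _ / e => hy.
by rewrite (proof_irrel hx hy).
Qed.

Declare Scope sup_scope.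
Open Scope sup_scope.

Record SupLat := {
  sup_car :> Type;
  le : sup_car -> sup_car -> Prop;
  sup : (sup_car -> Prop) -> sup_car;
  le_refl : forall x, le x x;
  le_trans : forall x y z, le x y -> le y z -> le x z;
  le_anti : forall x y, le x y -> le y x -> x = y;
  sup_le : forall S x, le (sup S) x <-> (forall y, S y -> le y x)
}.
Arguments le {s} _ _.
Arguments sup {s} _.
Arguments le_refl {s} _.
Arguments le_trans {s} [x y z] _ _.
Arguments le_anti {s} [x y] _ _.
Arguments sup_le {s} S x.
Notation "x <= y" := (le x y) : sup_scope.

Definition bot {A : SupLat} : A := sup (fun _ => False).
Definition top {A : SupLat} : A := sup (fun _ => True).
Definition join {A : SupLat} (a b : A) : A := sup (fun x => x = a \/ x = b).

Definition image {A B : Type} (f : A -> B) (S : A -> Prop) : B -> Prop :=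
  fun y => exists2 x, S x & y = f x.

Definition sup_preserving {A B : SupLat} (f : A -> B) : Prop :=
  forall S, f (sup S) = sup (image f S).

Record SupHom (A B : SupLat) := {
  sup_fun :> A -> B;
  sup_fun_sup : sup_preserving sup_fun
}.

Lemma sup_ub (A : SupLat) (S : A -> Prop) x : S x -> x <= sup S.
Proof. by move: (proj1 (sup_le S (sup S)) (le_refl _)); apply. Qed.

Lemma top_ub (A : SupLat) (x : A) : x <= top.
Proof. exact: sup_ub. Qed.

Lemma le_eq (A : SupLat) (x y : A) : x = y -> x <= y.
Proof. move=> ->; exact: le_refl. Qed.

Lemma sup_ext (A : SupLat) (S T : A -> Prop) :
  (forall x, S x <-> T x) -> sup S = sup T.
Proof.
by move=> h; congr sup; apply: functional_extensionality => x;
  apply: propositional_extensionality.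
Qed.

Lemma le_char (A : SupLat) (x y : A) :
  (forall z, x <= z <-> y <= z) -> x = y.
Proof. by move=> h; apply: le_anti; apply/h; apply: le_refl. Qed.

Lemma join_le (A : SupLat) (a b c : A) : join a b <= c <-> a <= c /\ b <= c.
Proof.
rewrite sup_le; split=> [h|[ha hb] y [->|->]] //.
by split; apply: h; [left|right].
Qed.

Lemma join_idr (A : SupLat) (a b : A) : a <= b -> join a b = b.
Proof.
move=> h; apply: le_anti; first by apply/join_le; split=> //; apply: le_refl.
by apply: sup_ub; right.
Qed.

Lemma sup_preserving_mono (A B : SupLat) (f : A -> B) :
  sup_preserving f -> forall x y, x <= y -> f x <= f y.
Proof.
move=> hf x y hxy; rewrite -(join_idr hxy) hf.
by apply: sup_ub; exists x => //; left.
Qed.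

Lemma adjoint_sup_preserving (A B : SupLat) (f : A -> B) (g : B -> A) :
  (forall x y, f x <= y <-> x <= g y) -> sup_preserving f.
Proof.
move=> h S; apply: le_char => z; rewrite h !sup_le; split.
- by move=> hS y [x Sx ->]; apply/h/hS.
- by move=> hS x Sx; apply/h/hS; exists x.
Qed.

Lemma sup_hom_eq (A B : SupLat) (f g : SupHom A B) :
  (forall x, f x = g x) -> f = g.
Proof.
case: f g => [f hf] [g hg] /= /functional_extensionality e.
by move: hg; case: _ / e => hg; rewrite (proof_irrel hf hg).
Qed.

Lemma hom_mono (A B : SupLat) (f : SupHom A B) x y : x <= y -> f x <= f y.
Proof. exact: sup_preserving_mono (sup_fun_sup f) x y. Qed.

Lemma id_sup_preserving (A : SupLat) : sup_preserving (fun x : A => x).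
Proof.
by move=> S; apply: sup_ext => x; split=> [Sx|[y Sy ->]] //; exists x.
Qed.

Definition sup_id (A : SupLat) : SupHom A A :=
  {| sup_fun := fun x => x; sup_fun_sup := @id_sup_preserving A |}.

Lemma comp_sup_preserving (A B C : SupLat) (g : B -> C) (f : A -> B) :
  sup_preserving g -> sup_preserving f -> sup_preserving (fun x => g (f x)).
Proof.
move=> hg hf S; rewrite hf hg; apply: sup_ext => z; split.
- by move=> [_ [x Sx ->] ->]; exists x.
- by move=> [x Sx ->]; exists (f x) => //; exists x.
Qed.

Definition sup_comp (A B C : SupLat) (g : SupHom B C) (f : SupHom A B) : SupHom A C :=
  {| sup_fun := fun x => g (f x);
     sup_fun_sup := comp_sup_preserving (sup_fun_sup g) (sup_fun_sup f) |}.

Lemma sup_compE (A B C : SupLat) (g : SupHom B C) (f : SupHom A B) x :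
  sup_comp g f x = g (f x).
Proof. by []. Qed.

Lemma hom_bot (A B : SupLat) (f : SupHom A B) : f bot = bot.
Proof. by rewrite /bot sup_fun_sup; apply: sup_ext => x; split=> // -[]. Qed.

Lemma hom_join (A B : SupLat) (f : SupHom A B) a b :
  f (join a b) = join (f a) (f b).
Proof.
rewrite /join sup_fun_sup; apply: sup_ext => y; split.
- by move=> [x [->|->] ->]; [left|right].
- by move=> [->|->]; [exists a => //; left|exists b => //; right].
Qed.

Definition Omega : SupLat.
Proof.
refine {| sup_car := Prop; le := fun p q => p -> q;
          sup := fun S => exists2 p, S p & p |} => //.
- by move=> p q r hpq hqr /hpq.
- by move=> p q hpq hqp; apply: propositional_extensionality.
- move=> S q; split=> [h p Sp hp|h [p Sp hp]]; first by apply: h; exists p.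
  exact: h Sp hp.
Defined.

Definition hom_sup (A B : SupLat) (F : SupHom A B -> Prop) : SupHom A B.
Proof.
refine {| sup_fun := fun a => sup (fun b => exists2 f : SupHom A B, F f & b = f a) |}.
move=> S; apply: le_char => z; rewrite !sup_le; split.
- move=> h _ [a Sa ->]; apply/sup_le => _ [f Ff ->].
  apply: le_trans (h _ (ex_intro2 _ _ f Ff (eq_refl _))).
  exact: hom_mono (sup_ub Sa).
- move=> h _ [f Ff ->]; rewrite sup_fun_sup; apply/sup_le => _ [a Sa ->].
  apply: le_trans (h _ (ex_intro2 _ _ a Sa (eq_refl _))).
  by apply: sup_ub; exists f.
Defined.

Definition hom (A B : SupLat) : SupLat.
Proof.
refine {| sup_car := SupHom A B; le := fun f g => forall x, f x <= g x;
          sup := @hom_sup A B |}.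
- by move=> f x; apply: le_refl.
- by move=> f g h hfg hgh x; apply: le_trans (hfg x) (hgh x).
- by move=> f g hfg hgf; apply: sup_hom_eq => x; apply: le_anti.
- move=> F g; split=> [h f Ff x|h x].
  + by apply: le_trans (h x); apply: sup_ub; exists f.
  + by apply/sup_le => _ [f Ff ->]; apply: h.
Defined.

(** [tensor A B] is the suplattice of bi-ideals: relations from [A] to [B] that
    are, in each variable, down-closed and closed under joins. *)
Definition bi_ideal (A B : SupLat) (D : A -> B -> Prop) : Prop :=
  (forall S b, D (sup S) b <-> forall a, S a -> D a b) /\
  (forall a T, D a (sup T) <-> forall b, T b -> D a b).

Lemma bi_ideal_down (A B : SupLat) (D : A -> B -> Prop) a a' b b' :
  bi_ideal D -> a' <= a -> b' <= b -> D a b -> D a' b'.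
Proof.
move=> [hl hr] ha hb Dab.
have Da'b : D a' b.
  by move: Dab; rewrite -(join_idr ha) hl; apply; left.
by move: Da'b; rewrite -(join_idr hb) hr; apply; left.
Qed.

Lemma bi_ideal_inter (A B : SupLat) (I : (A -> B -> Prop) -> Prop) :
  bi_ideal (fun a b => forall E, bi_ideal E -> I E -> E a b).
Proof.
split=> [S b|a T]; split.
- by move=> h a Sa E hE IE; apply: (proj1 (proj1 hE S b) (h E hE IE)).
- by move=> h E hE IE; apply/(proj1 hE) => a Sa; apply: h.
- by move=> h b Tb E hE IE; apply: (proj1 (proj2 hE a T) (h E hE IE)).
- by move=> h E hE IE; apply/(proj2 hE) => b Tb; apply: h.
Qed.

Definition tensor_car (A B : SupLat) : Type := {D : A -> B -> Prop | bi_ideal D}.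

Definition tensor_rel (A B : SupLat) (D : tensor_car A B) : A -> B -> Prop :=
  proj1_sig D.
Coercion tensor_rel : tensor_car >-> Funclass.

Definition tensor (A B : SupLat) : SupLat.
Proof.
refine {| sup_car := tensor_car A B;
          le := fun D E => forall a b, D a b -> E a b;
          sup := fun F => exist _ _ (@bi_ideal_inter A B
            (fun E => forall D : tensor_car A B, F D -> forall a b, D a b -> E a b)) |}.
- by [].
- by move=> D E F hDE hEF a b /hDE /hEF.
- move=> D E hDE hED; apply: sig_ext.
  apply: functional_extensionality => a; apply: functional_extensionality => b.
  by apply: propositional_extensionality; split; [apply: hDE|apply: hED].
- move=> F E; split=> [h D FD a b Dab|h a b /= hab].
  + by apply: h => G hG hI; apply: (hI D FD).
  + by apply: hab; [apply: (proj2_sig E)|apply: h].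
Defined.

Lemma tensor_sup_l (A B : SupLat) (D : tensor_car A B) S b :
  D (sup S) b <-> forall a, S a -> D a b.
Proof. exact: (proj1 (proj2_sig D)). Qed.

Lemma tensor_sup_r (A B : SupLat) (D : tensor_car A B) a T :
  D a (sup T) <-> forall b, T b -> D a b.
Proof. exact: (proj2 (proj2_sig D)). Qed.

Definition pure (A B : SupLat) (a : A) (b : B) : tensor A B :=
  exist _ _ (@bi_ideal_inter A B (fun E => E a b)).

Lemma pure_le (A B : SupLat) (a : A) (b : B) (D : tensor A B) :
  pure a b <= D <-> (D : tensor_car A B) a b.
Proof.
split=> [|h x y hxy]; first by apply=> E.
by apply: hxy => //; apply: proj2_sig D.
Qed.

Record BiHom (A B C : SupLat) := {
  bi_fun :> A -> B -> C;
  bi_fun_l : forall b, sup_preserving (fun a => bi_fun a b);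
  bi_fun_r : forall a, sup_preserving (bi_fun a)
}.

Definition pure_bihom (A B : SupLat) : BiHom A B (tensor A B).
Proof.
refine {| bi_fun := @pure A B |}.
- move=> b S; apply: le_char => D; rewrite pure_le sup_le tensor_sup_l.
  split=> [h _ [a Sa ->]|h a Sa]; first by apply/pure_le/h.
  by apply/pure_le/h; exists a.
- move=> a T; apply: le_char => D; rewrite pure_le sup_le tensor_sup_r.
  split=> [h _ [b Tb ->]|h b Tb]; first by apply/pure_le/h.
  by apply/pure_le/h; exists b.
Defined.

Lemma lift_adj_bi_ideal (A B C : SupLat) (f : BiHom A B C) (c : C) :
  bi_ideal (fun a b => f a b <= c).
Proof.
split=> [S b|a T].
- rewrite (bi_fun_l f b S) sup_le; split=> [h a Sa|h _ [a Sa ->]]; last exact: h.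
  by apply: h; exists a.
- rewrite (bi_fun_r f a T) sup_le; split=> [h b Tb|h _ [b Tb ->]]; last exact: h.
  by apply: h; exists b.
Qed.

Definition tensor_lift (A B C : SupLat) (f : BiHom A B C) : SupHom (tensor A B) C.
Proof.
refine {| sup_fun := fun D : tensor A B =>
  sup (fun c => exists a b, (D : tensor_car A B) a b /\ c = f a b) |}.
apply: (adjoint_sup_preserving
  (g := fun c => exist _ _ (lift_adj_bi_ideal f c) : tensor A B)) => D c.
rewrite sup_le; split=> [h a b Dab|h _ [a [b [Dab ->]]]].
- by apply: h; exists a, b.
- exact: h.
Defined.

Lemma tensor_lift_le (A B C : SupLat) (f : BiHom A B C) (D : tensor A B) c :
  tensor_lift f D <= c <-> forall a b, (D : tensor_car A B) a b -> f a b <= c.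
Proof.
rewrite sup_le; split=> [h a b Dab|h _ [a [b [Dab ->]]]]; last exact: h.
by apply: h; exists a, b.
Qed.

Lemma tensor_lift_pure (A B C : SupLat) (f : BiHom A B C) a b :
  tensor_lift f (pure a b) = f a b.
Proof.
apply: le_char => c; split.
- by move=> /tensor_lift_le; apply=> E.
- move=> h; apply/tensor_lift_le.
  exact: (proj2 (pure_le a b (exist _ _ (lift_adj_bi_ideal f c))) h).
Qed.

Lemma tensor_gen (A B : SupLat) (D : tensor A B) :
  D = sup (fun E => exists a b, (D : tensor_car A B) a b /\ E = pure a b).
Proof.
apply: le_char => E; rewrite sup_le; split.
- by move=> h _ [a [b [Dab ->]]]; apply/pure_le/h.
- by move=> h a b Dab; apply/pure_le/h; exists a, b.
Qed.

Lemma tensor_hom_eq (A B C : SupLat) (f g : SupHom (tensor A B) C) :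
  (forall a b, f (pure a b) = g (pure a b)) -> f = g.
Proof.
move=> h; apply: sup_hom_eq => D; rewrite (tensor_gen D) !sup_fun_sup.
apply: sup_ext => c; split=> -[_ [a [b [Dab ->]]] ->];
  by exists (pure a b); rewrite ?h //; exists a, b.
Qed.

Definition bi_comp (A B C A' B' : SupLat) (h : BiHom A' B' C)
  (f : SupHom A A') (g : SupHom B B') : BiHom A B C.
Proof.
refine {| bi_fun := fun a b => h (f a) (g b) |}.
- move=> b; exact: comp_sup_preserving (bi_fun_l h (g b)) (sup_fun_sup f).
- move=> a; exact: comp_sup_preserving (bi_fun_r h (f a)) (sup_fun_sup g).
Defined.

Definition tensor_map (A B A' B' : SupLat) (f : SupHom A A') (g : SupHom B B') :
  SupHom (tensor A B) (tensor A' B') :=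
  tensor_lift (bi_comp (pure_bihom A' B') f g).

Lemma tensor_map_pure (A B A' B' : SupLat) (f : SupHom A A') (g : SupHom B B') a b :
  tensor_map f g (pure a b) = pure (f a) (g b).
Proof. exact: tensor_lift_pure. Qed.

Lemma tensor_map_id (A B : SupLat) :
  tensor_map (sup_id A) (sup_id B) = sup_id (tensor A B).
Proof. by apply: tensor_hom_eq => a b; rewrite tensor_map_pure. Qed.

Lemma tensor_map_comp (A B A' B' A'' B'' : SupLat)
  (f' : SupHom A' A'') (f : SupHom A A') (g' : SupHom B' B'') (g : SupHom B B') :
  sup_comp (tensor_map f' g') (tensor_map f g) =
  tensor_map (sup_comp f' f) (sup_comp g' g).
Proof. by apply: tensor_hom_eq => a b; rewrite sup_compE !tensor_map_pure. Qed.

Lemma scale_adj (A : SupLat) (a b : A) (p : Prop) :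
  sup (fun x => p /\ x = a) <= b <-> (p -> a <= b).
Proof.
rewrite sup_le; split=> [h hp|h _ [hp ->]]; first exact: h.
exact: h.
Qed.

Definition scale (A : SupLat) : BiHom Omega A A.
Proof.
refine {| bi_fun := fun (p : Omega) a => sup (fun x => p /\ x = a) |}.
- move=> a S; apply: le_char => z; apply: iff_trans (scale_adj _ _ _) _.
  apply: iff_trans _ (iff_sym (sup_le _ _)); split.
  + by move=> h _ [p Sp ->]; apply/scale_adj => hp; apply: h; exists p.
  + move=> h [p Sp hp]; have := h _ (ex_intro2 _ _ p Sp (eq_refl _)).
    by move/scale_adj; apply.
- move=> p S; apply: le_char => z; apply: iff_trans (scale_adj _ _ _) _.
  apply: iff_trans _ (iff_sym (sup_le _ _)); split.
  + move=> h _ [a Sa ->]; apply/scale_adj => hp.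
    exact: le_trans (sup_ub Sa) (h hp).
  + move=> h hp; apply/sup_le => a Sa.
    have := h _ (ex_intro2 _ _ a Sa (eq_refl _)).
    by move/scale_adj; apply.
Defined.

Definition bi_swap (A B C : SupLat) (f : BiHom A B C) : BiHom B A C :=
  {| bi_fun := fun b a => f a b; bi_fun_l := bi_fun_r f; bi_fun_r := bi_fun_l f |}.

Definition lunit (A : SupLat) : SupHom (tensor Omega A) A := tensor_lift (scale A).
Definition runit (A : SupLat) : SupHom (tensor A Omega) A :=
  tensor_lift (bi_swap (scale A)).
Definition lunit_inv (A : SupLat) : SupHom A (tensor Omega A) :=
  {| sup_fun := fun a => @pure Omega A True a;
     sup_fun_sup := bi_fun_r (pure_bihom Omega A) True |}.
Definition runit_inv (A : SupLat) : SupHom A (tensor A Omega) :=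
  {| sup_fun := fun a => @pure A Omega a True;
     sup_fun_sup := bi_fun_l (pure_bihom A Omega) True |}.

Lemma tensor_map_sup_r (A B A' B' : SupLat) (f : SupHom A A') (D : tensor A B) :
  sup_preserving (fun g : hom B B' => tensor_map f g D).
Proof.
move=> G; apply: le_char => E; rewrite tensor_lift_le sup_le; split.
- move=> h _ [g Gg ->]; apply/tensor_lift_le => a b Dab.
  apply: le_trans (h a b Dab).
  apply: (sup_preserving_mono (bi_fun_r (pure_bihom A' B') (f a))).
  by apply: sup_ub; exists g.
- move=> h a b Dab /=.
  change (pure_bihom A' B' (f a) (sup (fun b' => exists2 g : hom B B', G g & b' = g b)) <= E).
  rewrite (bi_fun_r (pure_bihom A' B') (f a) _); apply/sup_le => _ [_ [g Gg ->] ->].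
  have := h _ (ex_intro2 _ _ g Gg (eq_refl _)).
  by move/tensor_lift_le; apply.
Qed.

Lemma tensor_map_sup_l (A B A' B' : SupLat) (g : SupHom B B') (D : tensor A B) :
  sup_preserving (fun f : hom A A' => tensor_map f g D).
Proof.
move=> F; apply: le_char => E; rewrite tensor_lift_le sup_le; split.
- move=> h _ [f Ff ->]; apply/tensor_lift_le => a b Dab.
  apply: le_trans (h a b Dab).
  apply: (sup_preserving_mono (bi_fun_l (pure_bihom A' B') (g b))).
  by apply: sup_ub; exists f.
- move=> h a b Dab /=.
  change (pure_bihom A' B' (sup (fun a' => exists2 f : hom A A', F f & a' = f a)) (g b) <= E).
  rewrite (bi_fun_l (pure_bihom A' B') (g b) _); apply/sup_le => _ [_ [f Ff ->] ->].
  have := h _ (ex_intro2 _ _ f Ff (eq_refl _)).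
  by move/tensor_lift_le; apply.
Qed.

Definition pure_l (A B : SupLat) (a : A) : SupHom B (tensor A B) :=
  {| sup_fun := pure a; sup_fun_sup := bi_fun_r (pure_bihom A B) a |}.
Definition pure_r (A B : SupLat) (b : B) : SupHom A (tensor A B) :=
  {| sup_fun := fun a => pure a b; sup_fun_sup := bi_fun_l (pure_bihom A B) b |}.

Lemma pure_l_sup (A B : SupLat) : sup_preserving (@pure_l A B : A -> hom B (tensor A B)).
Proof.
move=> S; apply: sup_hom_eq => b /=.
apply: eq_trans (bi_fun_l (pure_bihom A B) b S) _; apply: sup_ext => D; split.
- by move=> [a Sa ->]; exists (pure_l B a) => //; exists a.
- by move=> [_ [a Sa ->] ->]; exists a.
Qed.

Lemma pure_r_sup (A B : SupLat) : sup_preserving (@pure_r A B : B -> hom A (tensor A B)).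
Proof.
move=> S; apply: sup_hom_eq => a /=.
apply: eq_trans (bi_fun_r (pure_bihom A B) a S) _; apply: sup_ext => D; split.
- by move=> [b Sb ->]; exists (pure_r A b) => //; exists b.
- by move=> [_ [b Sb ->] ->]; exists b.
Qed.

Definition assoc_bihom (A B C : SupLat) :
  BiHom (tensor A B) C (tensor A (tensor B C)).
Proof.
refine {| bi_fun := fun D c => tensor_map (sup_id A) (pure_r B c) D |}.
- by move=> c; apply: sup_fun_sup.
- move=> D; exact: (comp_sup_preserving
    (tensor_map_sup_r (sup_id A) D) (@pure_r_sup B C)).
Defined.

Definition assoc_inv_bihom (A B C : SupLat) :
  BiHom A (tensor B C) (tensor (tensor A B) C).
Proof.
refine {| bi_fun := fun a D => tensor_map (pure_l B a) (sup_id C) D |}.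
- move=> D; exact: (comp_sup_preserving
    (tensor_map_sup_l (sup_id C) D) (@pure_l_sup A B)).
- by move=> a; apply: sup_fun_sup.
Defined.

Definition assoc (A B C : SupLat) :
  SupHom (tensor (tensor A B) C) (tensor A (tensor B C)) :=
  tensor_lift (assoc_bihom A B C).
Definition assoc_inv (A B C : SupLat) :
  SupHom (tensor A (tensor B C)) (tensor (tensor A B) C) :=
  tensor_lift (assoc_inv_bihom A B C).

Lemma assoc_pure (A B C : SupLat) (a : A) (b : B) (c : C) :
  assoc A B C (pure (pure a b) c) = pure a (pure b c).
Proof. by rewrite tensor_lift_pure; apply: tensor_map_pure. Qed.

Lemma assoc_inv_pure (A B C : SupLat) (a : A) (b : B) (c : C) :
  assoc_inv A B C (pure a (pure b c)) = pure (pure a b) c.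
Proof. by rewrite tensor_lift_pure; apply: tensor_map_pure. Qed.

Definition is_duality (S D : SupLat)
  (counit : SupHom (tensor S D) Omega) (unit : SupHom Omega (tensor D S)) : Prop :=
  sup_comp (lunit S) (sup_comp (tensor_map counit (sup_id S))
    (sup_comp (assoc_inv S D S) (sup_comp (tensor_map (sup_id S) unit) (runit_inv S))))
    = sup_id S
  /\
  sup_comp (runit D) (sup_comp (tensor_map (sup_id D) counit)
    (sup_comp (assoc D S D) (sup_comp (tensor_map unit (sup_id D)) (lunit_inv D))))
    = sup_id D.

Definition dualisable (S : SupLat) : Prop :=
  exists (D : SupLat) (counit : SupHom (tensor S D) Omega)
    (unit : SupHom Omega (tensor D S)), is_duality counit unit.

Record Quantale := {
  q_sup :> SupLat;
  mul : q_sup -> q_sup -> q_sup;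
  one : q_sup;
  mulA : forall a b c, mul a (mul b c) = mul (mul a b) c;
  mulC : forall a b, mul a b = mul b a;
  mul1 : forall a, mul one a = a;
  mul_sup : forall a, sup_preserving (mul a)
}.
Arguments mul {q} _ _.
Arguments one {q}.
Arguments mulA {q} a b c.
Arguments mulC {q} a b.
Arguments mul1 {q} a.
Arguments mul_sup {q} a.

Record QuantaleHom (P Q : Quantale) := {
  q_hom :> SupHom P Q;
  q_hom_mul : forall a b, q_hom (mul a b) = mul (q_hom a) (q_hom b);
  q_hom_one : q_hom one = one
}.

Lemma q_hom_eq (P Q : Quantale) (f g : QuantaleHom P Q) :
  (forall x, f x = g x) -> f = g.
Proof.
case: f g => [f hf1 hf2] [g hg1 hg2] /= /sup_hom_eq e.
move: hg1 hg2; case: _ / e => hg1 hg2.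
by rewrite (proof_irrel hf1 hg1) (proof_irrel hf2 hg2).
Qed.

Definition q_id (Q : Quantale) : QuantaleHom Q Q.
Proof. by refine {| q_hom := sup_id Q |}. Defined.

Definition q_comp (P Q R : Quantale) (g : QuantaleHom Q R) (f : QuantaleHom P Q) :
  QuantaleHom P R.
Proof.
refine {| q_hom := sup_comp g f |} => [a b|] /=.
- by rewrite !q_hom_mul.
- by rewrite !q_hom_one.
Defined.

Lemma q_compE (P Q R : Quantale) (g : QuantaleHom Q R) (f : QuantaleHom P Q) x :
  q_comp g f x = g (f x).
Proof. by []. Qed.

Definition two_sided (Q : Quantale) : Prop := one = top :> Q.

Lemma mul_mono (Q : Quantale) (a a' b b' : Q) :
  a <= a' -> b <= b' -> mul a b <= mul a' b'.
Proof.
move=> ha hb; apply: le_trans (sup_preserving_mono (mul_sup a) hb) _.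
by rewrite ![mul _ b']mulC; apply: (sup_preserving_mono (mul_sup b') ha).
Qed.

Record Nucleus (Q : Quantale) := {
  nuc :> Q -> Q;
  nuc_mono : forall a b, a <= b -> nuc a <= nuc b;
  nuc_infl : forall a, a <= nuc a;
  nuc_idem : forall a, nuc (nuc a) = nuc a;
  nuc_mul : forall a b, mul (nuc a) (nuc b) <= nuc (mul a b)
}.

Lemma nuc_le (Q : Quantale) (j : Nucleus Q) a b : j b = b -> (j a <= b <-> a <= b).
Proof.
move=> e; split=> h; first exact: le_trans (nuc_infl j a) h.
by rewrite -e; apply: nuc_mono.
Qed.

Lemma nuc_mulr (Q : Quantale) (j : Nucleus Q) a b : j (mul a (j b)) = j (mul a b).
Proof.
apply: le_anti.
- apply/nuc_le; first exact: nuc_idem.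
  apply: le_trans (nuc_mul j a b); apply: mul_mono; last exact: le_refl.
  exact: nuc_infl.
- by apply/nuc_mono/mul_mono; [apply: le_refl|apply: nuc_infl].
Qed.

Definition nuc_sup (Q : Quantale) (j : Nucleus Q) : SupLat.
Proof.
refine {| sup_car := {a : Q | j a = a};
          le := fun a b => proj1_sig a <= proj1_sig b;
          sup := fun S => exist _ (j (sup (image (@proj1_sig _ _) S))) (nuc_idem j _) |}.
- by move=> a; apply: le_refl.
- by move=> a b c; apply: le_trans.
- by move=> a b hab hba; apply/sig_ext/le_anti.
- move=> S [x hx] /=; rewrite nuc_le // sup_le; split.
  + by move=> h y Sy; apply: h; exists y.
  + by move=> h _ [y Sy ->]; apply: h.
Defined.

Definition nuc_quot (Q : Quantale) (j : Nucleus Q) : Quantale.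
Proof.
refine {| q_sup := nuc_sup j;
          mul := fun a b =>
            exist _ (j (mul (proj1_sig a) (proj1_sig b))) (nuc_idem j _) : nuc_sup j;
          one := exist _ (j one) (nuc_idem j _) : nuc_sup j |}.
- move=> a b c; apply: sig_ext => /=.
  rewrite nuc_mulr [mul (j _) _]mulC nuc_mulr mulA [mul (proj1_sig c) _]mulC.
  by [].
- by move=> a b; apply: sig_ext => /=; rewrite mulC.
- by move=> [a ha]; apply: sig_ext => /=; rewrite mulC nuc_mulr mulC mul1.
- move=> a S; apply: sig_ext => /=; rewrite nuc_mulr mul_sup.
  apply: le_char => z; split=> h.
  + apply: le_trans h; apply/nuc_le; first exact: nuc_idem.
    apply/sup_le => _ [_ [b Sb ->] ->] /=; apply: nuc_mono; apply: sup_ub.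
    by exists (proj1_sig b) => //; exists b.
  + apply: le_trans h; apply: nuc_mono; apply/sup_le => _ [_ [b Sb ->] ->].
    apply: le_trans (nuc_infl j _) _; apply: sup_ub.
    by exists (exist (fun x => j x = x) (j (mul (proj1_sig a) (proj1_sig b))) (nuc_idem j _)) => //;
      exists b.
Defined.

Definition nuc_proj (Q : Quantale) (j : Nucleus Q) : QuantaleHom Q (nuc_quot j).
Proof.
unshelve refine {| q_hom := {| sup_fun := fun a =>
  exist _ (j a) (nuc_idem j a) : nuc_quot j |} |}.
- apply: (adjoint_sup_preserving (B := nuc_quot j)
    (g := fun b : nuc_quot j => proj1_sig b)) => a [b hb] /=.
  exact: nuc_le.
- move=> a b; apply: sig_ext => /=.
  by rewrite nuc_mulr [mul (j a) b]mulC nuc_mulr [mul b a]mulC.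
- exact: sig_ext.
Defined.

Definition nuc_factor (Q P : Quantale) (j : Nucleus Q) (f : QuantaleHom Q P)
  (hf : forall a, f (j a) = f a) : QuantaleHom (nuc_quot j) P.
Proof.
unshelve refine {| q_hom := {| sup_fun := fun a : nuc_quot j => f (proj1_sig a) |} |}.
- move=> S /=; rewrite hf sup_fun_sup; apply: sup_ext => x; split.
  + by move=> [_ [a Sa ->] ->]; exists a.
  + by move=> [a Sa ->]; exists (proj1_sig a) => //; exists a.
- by move=> a b /=; rewrite hf q_hom_mul.
- by rewrite /= hf q_hom_one.
Defined.

Lemma nuc_factor_proj (Q P : Quantale) (j : Nucleus Q) (f : QuantaleHom Q P)
  (hf : forall a, f (j a) = f a) : q_comp (nuc_factor hf) (nuc_proj j) = f.
Proof. by apply: q_hom_eq => a /=; rewrite hf. Qed.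

(** Quantale congruences: equivalence relations [E] on [Q] that are subquantales
    of [Q * Q]. *)
Record quantale_cong (Q : Quantale) (E : Q -> Q -> Prop) : Prop := {
  cong_refl : forall a, E a a;
  cong_sym : forall a b, E a b -> E b a;
  cong_trans : forall a b c, E a b -> E b c -> E a c;
  cong_mul : forall a b a' b', E a b -> E a' b' -> E (mul a a') (mul b b');
  cong_sup : forall T : Q -> Q -> Prop, (forall a b, T a b -> E a b) ->
    E (sup (fun a => exists b, T a b)) (sup (fun b => exists a, T a b))
}.

Definition cong_gen (Q : Quantale) (G : Q -> Q -> Prop) (a b : Q) : Prop :=
  forall E : Q -> Q -> Prop, quantale_cong E -> (forall x y, G x y -> E x y) -> E a b.

Lemma cong_gen_cong (Q : Quantale) (G : Q -> Q -> Prop) : quantale_cong (cong_gen G).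
Proof.
split.
- by move=> a E hE _; apply: (cong_refl hE).
- by move=> a b h E hE hG; apply: (cong_sym hE); apply: h.
- by move=> a b c h h' E hE hG; apply: (cong_trans hE (h E hE hG) (h' E hE hG)).
- by move=> a b a' b' h h' E hE hG; apply: (cong_mul hE (h E hE hG) (h' E hE hG)).
- by move=> T hT E hE hG; apply: (cong_sup hE) => a b /hT; apply.
Qed.

Lemma cong_gen_of (Q : Quantale) (G : Q -> Q -> Prop) x y : G x y -> cong_gen G x y.
Proof. by move=> h E _; apply. Qed.

Lemma cong_class_sup (Q : Quantale) (E : Q -> Q -> Prop) (hE : quantale_cong E) a :
  E a (sup (E a)).
Proof.
have := cong_sup hE (T := fun x y => x = a /\ E a y).
have -> : sup (fun x => exists y, x = a /\ E a y) = a.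
  apply: le_anti; first by apply/sup_le => x [y [-> _]]; apply: le_refl.
  by apply: sup_ub; exists a; split=> //; apply: cong_refl.
have -> : sup (fun y => exists x, x = a /\ E a y) = sup (E a).
  by apply: sup_ext => y; split=> [[x []]|] //; exists a.
by apply=> x y [-> hy].
Qed.

Lemma cong_join (Q : Quantale) (E : Q -> Q -> Prop) (hE : quantale_cong E) a b a' b' :
  E a b -> E a' b' -> E (join a a') (join b b').
Proof.
move=> h h'; pose T x y := (x = a /\ y = b) \/ (x = a' /\ y = b').
have -> : join a a' = sup (fun x => exists y, T x y).
  apply: sup_ext => x; split; last by move=> [y [[-> _]|[-> _]]]; [left|right].
  by move=> [->|->]; [exists b; left|exists b'; right].
have -> : join b b' = sup (fun y => exists x, T x y).
  apply: sup_ext => y; split; last by move=> [x [[_ ->]|[_ ->]]]; [left|right].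
  by move=> [->|->]; [exists a; left|exists a'; right].
by apply: (cong_sup hE) => x y [[-> ->]|[-> ->]].
Qed.

Definition cong_nucleus (Q : Quantale) (E : Q -> Q -> Prop) (hE : quantale_cong E) :
  Nucleus Q.
Proof.
refine {| nuc := fun a => sup (E a) |}.
- move=> a b hab.
  have h : E b (join (sup (E a)) (sup (E b))).
    rewrite -{1}(join_idr hab).
    by apply: (cong_join hE); apply: (cong_class_sup hE).
  by apply: le_trans (sup_ub h); apply: sup_ub; left.
- by move=> a; apply: sup_ub; apply: cong_refl.
- move=> a; have h := cong_class_sup hE a.
  apply: sup_ext => x; split=> hx; first exact: (cong_trans hE h hx).
  exact: (cong_trans hE (cong_sym hE h) hx).
- move=> a b; apply: sup_ub.
  by apply: (cong_mul hE); apply: (cong_class_sup hE).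
Defined.

(** Since congruences are closed under joins, each class has a largest element, which
    represents it in the quotient. *)
Definition cong_quot (Q : Quantale) (G : Q -> Q -> Prop) : Quantale :=
  nuc_quot (cong_nucleus (cong_gen_cong G)).
Definition cong_proj (Q : Quantale) (G : Q -> Q -> Prop) :
  QuantaleHom Q (cong_quot G) :=
  nuc_proj (cong_nucleus (cong_gen_cong G)).

Lemma cong_proj_eq (Q : Quantale) (G : Q -> Q -> Prop) a b :
  cong_proj G a = cong_proj G b <-> cong_gen G a b.
Proof.
have hE := cong_gen_cong G; split.
- move=> /(f_equal (@proj1_sig _ _)) /= e.
  apply: (cong_trans hE (cong_class_sup hE a)).
  by rewrite e; apply: (cong_sym hE); apply: (cong_class_sup hE).
- move=> h; apply: sig_ext => /=; apply: sup_ext => x; split=> hx.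
  + exact: (cong_trans hE (cong_sym hE h) hx).
  + exact: (cong_trans hE h hx).
Qed.

Lemma cong_proj_surj (Q : Quantale) (G : Q -> Q -> Prop) (x : cong_quot G) :
  cong_proj G (proj1_sig x) = x.
Proof. by apply: sig_ext => /=; apply: proj2_sig x. Qed.

Lemma kernel_cong (P Q : Quantale) (f : QuantaleHom Q P) :
  quantale_cong (fun a b => f a = f b).
Proof.
split=> //.
- by move=> a b c -> ->.
- by move=> a b a' b' h h'; rewrite !q_hom_mul h h'.
- move=> T hT; rewrite !sup_fun_sup; apply: sup_ext => y; split.
  + by move=> [a [b Tab] ->]; exists b; [exists a|apply: hT].
  + by move=> [b [a Tab] ->]; exists a; [exists b|symmetry; apply: hT].
Qed.

Lemma cong_quot_universal (P Q : Quantale) (G : Q -> Q -> Prop) (f : QuantaleHom Q P) :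
  (forall x y, G x y -> f x = f y) ->
  exists! g : QuantaleHom (cong_quot G) P, q_comp g (cong_proj G) = f.
Proof.
move=> hG.
have hf : forall a, f (cong_nucleus (cong_gen_cong G) a) = f a.
  by move=> a; symmetry; apply: (cong_class_sup (cong_gen_cong G) a) (kernel_cong f) hG.
exists (nuc_factor hf); split; first exact: nuc_factor_proj.
move=> g hg; apply: q_hom_eq => x; rewrite -(cong_proj_surj x).
change (q_comp (nuc_factor hf) (cong_proj G) (proj1_sig x) =
        q_comp g (cong_proj G) (proj1_sig x)).
by rewrite hg /cong_proj nuc_factor_proj.
Qed.

(** Multiplication is then binary meet; see [meet_glb]. *)
Record Frame := {
  fr_q :> Quantale;
  fr_two_sided : two_sided fr_q;
  fr_idem : forall a : fr_q, mul a a = a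
}.

Definition FrameHom (A B : Frame) : Type := QuantaleHom A B.

Definition meet {A : Frame} (a b : A) : A := mul a b.

Lemma meet_glb (A : Frame) (a b c : A) : c <= meet a b <-> c <= a /\ c <= b.
Proof.
have hl : forall x y : A, mul x y <= y.
  move=> x y; rewrite -{2}(mul1 y); apply: mul_mono; last exact: le_refl.
  by rewrite fr_two_sided; apply: top_ub.
split=> [h|[ha hb]].
- split; apply: le_trans h _; last exact: hl.
  by rewrite /meet mulC; apply: hl.
- by rewrite -(fr_idem c); apply: mul_mono.
Qed.

Lemma fr_hom_top (A B : Frame) (f : FrameHom A B) : f top = top.
Proof.
rewrite -(fr_two_sided A) q_hom_one; exact: fr_two_sided.
Qed.

Lemma fr_top_mul (A : Frame) (a : A) : mul top a = a.
Proof. by rewrite -(fr_two_sided A) mul1. Qed.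

(** A locale is given by its frame of opens; a locale map [Y -> X] is a frame
    homomorphism from the opens of [X] to those of [Y]. *)
Definition Locale : Type := Frame.
Definition LocMap (Y X : Locale) : Type := FrameHom X Y.
Definition loc_id (X : Locale) : LocMap X X := q_id X.
Definition loc_comp (Z Y X : Locale) (f : LocMap Y X) (g : LocMap Z Y) : LocMap Z X :=
  q_comp g f.

Definition positive (A : SupLat) (a : A) : Prop :=
  forall I : A -> Prop, a <= sup I -> exists x, I x.

Definition overt (X : Locale) : Prop :=
  exists B : X -> Prop,
    (forall b, B b -> positive b) /\
    (forall a : X, a = sup (fun b => B b /\ b <= a)).

Definition Omega_frame : Frame.
Proof.
unshelve refine {| fr_q := {| q_sup := Omega; mul := and; one := True |} |}.
- by move=> p q r; apply: propositional_extensionality; tauto.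
- by move=> p q; apply: propositional_extensionality; tauto.
- by move=> p; apply: propositional_extensionality; tauto.
- move=> p S; apply: propositional_extensionality; split.
  + by move=> [hp [q Sq hq]]; exists (p /\ q) => //; exists q.
  + by move=> [_ [q Sq ->] [hp hq]]; split=> //; exists q.
- apply: propositional_extensionality; split=> // _.
  by exists True.
- by move=> p; apply: propositional_extensionality; split=> [[]|].
Defined.

Definition Delta : SupHom (tensor Omega Omega) Omega := lunit Omega.

Definition bang (X : Frame) : FrameHom Omega_frame X.
Proof.
refine {| q_hom := {| sup_fun := fun p : Omega => scale X p top;
    sup_fun_sup := bi_fun_l (scale X) top |} : SupHom Omega_frame X |}.
- move=> p q; apply: le_anti.
  + apply: (proj2 (scale_adj _ _ _)) => -[hp hq]; apply: (proj2 (meet_glb _ _ _)).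
    by split; apply: sup_ub.
  + rewrite mul_sup; apply/sup_le => _ [_ [hq ->] ->].
    rewrite mulC fr_top_mul; apply: (proj2 (scale_adj _ _ _)) => hp.
    by apply: sup_ub.
- rewrite (fr_two_sided X); apply: le_anti; first exact: top_ub.
  by apply: sup_ub.
Defined.

Lemma inter_bi_ideal (A B : SupLat) (D E : tensor_car A B) :
  bi_ideal (fun a b => D a b /\ E a b).
Proof.
split=> [S b|a T].
- rewrite !tensor_sup_l; split=> [[h h'] a Sa|h]; first by split; auto.
  by split=> a /h [].
- rewrite !tensor_sup_r; split=> [[h h'] b Tb|h]; first by split; auto.
  by split=> b /h [].
Qed.

Lemma total_bi_ideal (A B : SupLat) : bi_ideal (fun (_ : A) (_ : B) => True).
Proof. by split=> *; split. Qed.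

Lemma translate_bi_ideal (A B : Frame) (a : A) (b : B) (F : tensor_car A B) :
  bi_ideal (fun x y => F (mul a x) (mul b y)).
Proof.
split=> [S y|x T].
- rewrite (mul_sup a S) tensor_sup_l; split=> [h x Sx|h _ [x Sx ->]]; last exact: h.
  by apply: h; exists x.
- rewrite (mul_sup b T) tensor_sup_r; split=> [h y Ty|h _ [y Ty ->]]; last exact: h.
  by apply: h; exists y.
Qed.

Lemma residual_bi_ideal (A B : Frame) (D F : tensor_car A B) :
  bi_ideal (fun a b => forall a' b', D a' b' -> F (mul a' a) (mul b' b)).
Proof.
split=> [S b|a T]; split.
- move=> h a Sa a' b' Dab.
  by apply: (proj1 (proj1 (translate_bi_ideal a' b' F) S b)) => //; apply: h.
- move=> h a' b' Dab; apply/(proj1 (translate_bi_ideal a' b' F)) => a Sa.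
  exact: h.
- move=> h b Tb a' b' Dab.
  by apply: (proj1 (proj2 (translate_bi_ideal a' b' F) a T)) => //; apply: h.
- move=> h a' b' Dab; apply/(proj2 (translate_bi_ideal a' b' F)) => b Tb.
  exact: h.
Qed.

Lemma meet_lel (A : Frame) (a b : A) : mul a b <= a.
Proof. by have /meet_glb [] := le_refl (meet a b). Qed.
Lemma meet_ler (A : Frame) (a b : A) : mul a b <= b.
Proof. by have /meet_glb [] := le_refl (meet a b). Qed.

Definition coprod (A B : Frame) : Frame.
Proof.
unshelve refine {| fr_q := {| q_sup := tensor A B;
  mul := fun D E => exist _ _ (inter_bi_ideal D E) : tensor A B;
  one := exist _ _ (total_bi_ideal A B) : tensor A B |} |}.
- by move=> D E F; apply: le_anti => a b /=; tauto.
- by move=> D E; apply: le_anti => a b /=; tauto.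
- by move=> D; apply: le_anti => a b /=; tauto.
- move=> D; apply: (adjoint_sup_preserving (B := tensor A B)
    (g := fun F => exist _ _ (residual_bi_ideal D F) : tensor A B)) => E F; split.
  + move=> h a b Eab a' b' Dab; apply: h; split.
    * exact: bi_ideal_down (proj2_sig D) (meet_lel _ _) (meet_lel _ _) Dab.
    * exact: bi_ideal_down (proj2_sig E) (meet_ler _ _) (meet_ler _ _) Eab.
  + move=> h a b [Dab Eab]; have := h a b Eab a b Dab.
    by rewrite !fr_idem.
- by apply: le_anti; [apply: top_ub|].
- by move=> D; apply: le_anti => a b /=; tauto.
Defined.

Lemma pure_mul (A B : Frame) (a a' : A) (b b' : B) :
  mul (pure a b : coprod A B) (pure a' b' : coprod A B) = pure (mul a a') (mul b b').
Proof.
apply: le_anti.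
- have : forall F : tensor_car A B, F (mul a a') (mul b b') ->
      forall x y, (pure a b : tensor_car A B) x y ->
        (pure a' b' : tensor_car A B) x y -> F x y.
    move=> F hF x y h h'.
    have h1 := h' _ (translate_bi_ideal a b F) hF.
    have h2 : F (mul x x) (mul y y).
      by apply: (h _ (translate_bi_ideal x y F)); rewrite [mul x a]mulC [mul y b]mulC.
    by rewrite !fr_idem in h2.
  by move=> hF x y [h h']; apply: (hF (pure _ _)) h h' => E.
- apply/pure_le; split.
  + apply: (bi_ideal_down (proj2_sig (pure a b)) (meet_lel _ _) (meet_lel _ _)).
    by move=> E.
  + apply: (bi_ideal_down (proj2_sig (pure a' b')) (meet_ler _ _) (meet_ler _ _)).
    by move=> E.
Qed.

Lemma pure_top (A B : Frame) : pure (top : A) (top : B) = (top : coprod A B).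
Proof.
apply: le_anti; first exact: top_ub.
rewrite -(fr_two_sided (coprod A B)) => a b _.
apply: (bi_ideal_down (proj2_sig (pure top top)) (top_ub a) (top_ub b)).
by move=> E.
Qed.

Definition inl (A B : Frame) : FrameHom A (coprod A B).
Proof.
refine {| q_hom := pure_r A (top : B) : SupHom A (coprod A B) |}.
- by move=> a a'; symmetry; apply: eq_trans (pure_mul _ _ _ _) _; rewrite fr_idem.
- by rewrite (fr_two_sided A) (fr_two_sided (coprod A B)); apply: pure_top.
Defined.

Definition inr (A B : Frame) : FrameHom B (coprod A B).
Proof.
refine {| q_hom := pure_l B (top : A) : SupHom B (coprod A B) |}.
- by move=> a a'; symmetry; apply: eq_trans (pure_mul _ _ _ _) _; rewrite fr_idem.
- by rewrite (fr_two_sided B) (fr_two_sided (coprod A B)); apply: pure_top.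
Defined.

Lemma inl_mul_inr (A B : Frame) (a : A) (b : B) :
  mul (inl A B a) (inr A B b) = pure a b.
Proof.
apply: eq_trans (pure_mul _ _ _ _) _.
by rewrite fr_top_mul mulC fr_top_mul.
Qed.

Definition mul_bihom (Q : Quantale) : BiHom Q Q Q.
Proof.
refine {| bi_fun := mul; bi_fun_r := mul_sup |} => b S.
rewrite mulC mul_sup; apply: sup_ext => x.
by split=> -[a Sa ->]; exists a => //; rewrite mulC.
Defined.

Definition copair (A B C : Frame) (f : FrameHom A C) (g : FrameHom B C) :
  FrameHom (coprod A B) C.
Proof.
refine {| q_hom := tensor_lift (bi_comp (mul_bihom C) f g) : SupHom (coprod A B) C |}.
- move=> D E; apply: le_anti.
  + by apply/(meet_glb (A := C)); split; apply: hom_mono => a b [].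
  + rewrite {1}/tensor_lift /= mul_sup; apply/sup_le => _ [_ [a [b [Eab ->]]] ->].
    rewrite mulC mul_sup; apply/sup_le => _ [_ [a' [b' [Dab ->]]] ->].
    apply: sup_ub; exists (mul a' a), (mul b' b); split.
      by split;
        [apply: bi_ideal_down (proj2_sig D) (meet_lel _ _) (meet_lel _ _) Dab
        |apply: bi_ideal_down (proj2_sig E) (meet_ler _ _) (meet_ler _ _) Eab].
    rewrite /= !q_hom_mul mulC -!mulA; congr mul; rewrite !mulA; congr mul.
    exact: mulC.
- apply: le_anti; first by rewrite (fr_two_sided C); apply: top_ub.
  by apply: sup_ub; exists one, one; split=> //=; rewrite !q_hom_one mul1.
Defined.

Lemma copair_pure (A B C : Frame) (f : FrameHom A C) (g : FrameHom B C) a b :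
  copair f g (pure a b) = mul (f a) (g b).
Proof. exact: tensor_lift_pure. Qed.

Lemma copair_inl (A B C : Frame) (f : FrameHom A C) (g : FrameHom B C) :
  q_comp (copair f g) (inl A B) = f.
Proof.
apply: q_hom_eq => a; etransitivity; first exact: copair_pure.
by rewrite fr_hom_top mulC fr_top_mul.
Qed.

Lemma copair_inr (A B C : Frame) (f : FrameHom A C) (g : FrameHom B C) :
  q_comp (copair f g) (inr A B) = g.
Proof.
apply: q_hom_eq => a; etransitivity; first exact: copair_pure.
by rewrite fr_hom_top fr_top_mul.
Qed.

Lemma coprod_hom_eq (A B C : Frame) (f g : FrameHom (coprod A B) C) :
  q_comp f (inl A B) = q_comp g (inl A B) ->
  q_comp f (inr A B) = q_comp g (inr A B) -> f = g.
Proof.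
move=> hl hr; apply: q_hom_eq.
suff -> : q_hom f = q_hom g by [].
apply: tensor_hom_eq => a b.
rewrite -inl_mul_inr !q_hom_mul; congr mul.
- by change (q_comp f (inl A B) a = q_comp g (inl A B) a); rewrite hl.
- by change (q_comp f (inr A B) b = q_comp g (inr A B) b); rewrite hr.
Qed.

Lemma tensor_map_copair (A B A' B' : Frame) (f : FrameHom A A') (g : FrameHom B B') :
  tensor_map f g = copair (q_comp (inl A' B') f) (q_comp (inr A' B') g).
Proof.
apply: tensor_hom_eq => a b; rewrite tensor_map_pure.
symmetry; exact: (eq_trans (copair_pure (q_comp (inl A' B') f) (q_comp (inr A' B') g) a b)
  (inl_mul_inr (f a) (g b))).
Qed.

Definition coprod_map (A B A' B' : Frame) (f : FrameHom A A') (g : FrameHom B B') :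
  FrameHom (coprod A B) (coprod A' B').
Proof.
refine {| q_hom := tensor_map f g : SupHom (coprod A B) (coprod A' B') |}.
- by move=> D E; rewrite !tensor_map_copair q_hom_mul.
- by rewrite tensor_map_copair q_hom_one.
Defined.

Inductive idem_rel (Q : Quantale) : Q -> Q -> Prop :=
| idem_rel_intro a : idem_rel (mul a a) a.

Definition localic_reflection (Q : Quantale) (hQ : two_sided Q) : Frame.
Proof.
refine {| fr_q := cong_quot (@idem_rel Q) |}.
- apply: le_anti; first exact: top_ub.
  apply/sup_le => x _; rewrite -(cong_proj_surj x).
  rewrite -(q_hom_one (cong_proj (@idem_rel Q))) hQ.
  by apply: hom_mono; apply: top_ub.
- move=> x; rewrite -(cong_proj_surj x) -q_hom_mul.
  apply: (proj2 (cong_proj_eq _ _ _)); apply: cong_gen_of; constructor.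
Defined.

Definition reflection_unit (Q : Quantale) (hQ : two_sided Q) :
  QuantaleHom Q (localic_reflection hQ) := cong_proj (@idem_rel Q).

Lemma localic_reflection_universal (Q : Quantale) (hQ : two_sided Q) (F : Frame)
  (f : QuantaleHom Q F) :
  exists! g : FrameHom (localic_reflection hQ) F, q_comp g (reflection_unit hQ) = f.
Proof.
apply: (cong_quot_universal (G := @idem_rel Q)) => _ _ [a].
by rewrite q_hom_mul fr_idem.
Qed.

(** Read in the category of locales, [pt_op mu f g] is the composite of the pairing
    [X -> R * R] of [f] and [g] with the operation of which [mu] is the frame map,
    and [pr1], [pr2], [pr3] below are the projections [R * R * R -> R]. *)
Definition pt_op (R X : Frame) (mu : FrameHom R (coprod R R)) (f g : FrameHom R X) :
  FrameHom R X :=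
  q_comp (copair f g) mu.

Definition pt_const (R X : Frame) (e : FrameHom R Omega_frame) : FrameHom R X :=
  q_comp (bang X) e.

Definition pr1 (R : Frame) : FrameHom R (coprod (coprod R R) R) :=
  q_comp (inl (coprod R R) R) (inl R R).
Definition pr2 (R : Frame) : FrameHom R (coprod (coprod R R) R) :=
  q_comp (inl (coprod R R) R) (inr R R).
Definition pr3 (R : Frame) : FrameHom R (coprod (coprod R R) R) :=
  inr (coprod R R) R.

(** Commutative monoid objects in the category of locales: [co_op] and [co_unit] are
    the frame maps of the operation and of the neutral element, and each law is the
    usual diagram, expressed on the generic elements [pr1], [pr2], [pr3]. *)
Record LocCMonoid (R : Frame) := {
  co_op : FrameHom R (coprod R R);
  co_unit : FrameHom R Omega_frame;
  co_assoc : pt_op co_op (pt_op co_op (pr1 R) (pr2 R)) (pr3 R) =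
             pt_op co_op (pr1 R) (pt_op co_op (pr2 R) (pr3 R));
  co_comm : pt_op co_op (inr R R) (inl R R) = pt_op co_op (inl R R) (inr R R);
  co_neutral : pt_op co_op (pt_const R co_unit) (q_id R) = q_id R
}.

Record LocSemiring := {
  sr_fr :> Frame;
  sr_add : LocCMonoid sr_fr;
  sr_mul : LocCMonoid sr_fr;
  sr_distr :
    pt_op (co_op sr_mul) (pr1 sr_fr) (pt_op (co_op sr_add) (pr2 sr_fr) (pr3 sr_fr)) =
    pt_op (co_op sr_add) (pt_op (co_op sr_mul) (pr1 sr_fr) (pr2 sr_fr))
                         (pt_op (co_op sr_mul) (pr1 sr_fr) (pr3 sr_fr));
  sr_annihil :
    pt_op (co_op sr_mul) (pt_const sr_fr (co_unit sr_add)) (q_id sr_fr) =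
    pt_const sr_fr (co_unit sr_add)
}.

Definition eps0 (R : LocSemiring) : FrameHom R Omega_frame := co_unit (sr_add R).
Definition eps1 (R : LocSemiring) : FrameHom R Omega_frame := co_unit (sr_mul R).
Definition mu_add (R : LocSemiring) : FrameHom R (coprod R R) := co_op (sr_add R).
Definition mu_mul (R : LocSemiring) : FrameHom R (coprod R R) := co_op (sr_mul R).

(** An overt weakly closed sublocale of [R] is an element of [hom R Omega]. *)
Definition conv (R : Frame) (mu : SupHom R (tensor R R)) (f g : hom R Omega) :
  hom R Omega :=
  sup_comp Delta (sup_comp (tensor_map f g) mu).

Lemma Delta_pure (p q : Prop) : Delta (@pure Omega Omega p q) = (p /\ q).
Proof.
rewrite /Delta /lunit tensor_lift_pure /=; apply: propositional_extensionality.
by split=> [[_ [hp ->] hq]|[hp hq]] //; exists q.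
Qed.

Lemma Delta_map (R : Frame) (f g : SupHom R Omega) (D : tensor R R) :
  Delta (tensor_map f g D) <-> exists a b, (D : tensor_car R R) a b /\ f a /\ g b.
Proof.
rewrite {1}(tensor_gen D) !sup_fun_sup; split.
- move=> [_ [_ [_ [a [b [Dab ->]]] ->] ->]].
  by rewrite tensor_map_pure Delta_pure => -[fa gb]; exists a, b.
- move=> [a [b [Dab [fa gb]]]]; exists (Delta (tensor_map f g (pure a b))).
  + by exists (tensor_map f g (pure a b)) => //; exists (pure a b) => //; exists a, b.
  + by rewrite tensor_map_pure Delta_pure.
Qed.

Definition mul_hom (Q : Quantale) (a : Q) : SupHom Q Q :=
  {| sup_fun := mul a; sup_fun_sup := mul_sup a |}.

Definition conv_quantale (R : Frame) (M : LocCMonoid R) : Quantale.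
Proof.
refine {| q_sup := hom R Omega; mul := conv (co_op M); one := q_hom (co_unit M) |}.
- move=> f g h.
  pose L := sup_comp Delta (tensor_map (sup_comp Delta (tensor_map f g)) h).
  have eL : forall a b c, L (pure (pure a b) c) = ((f a /\ g b) /\ h c).
    move=> a b c; rewrite sup_compE tensor_map_pure Delta_pure.
    by rewrite sup_compE tensor_map_pure Delta_pure.
  have eA := co_assoc M.
  set l := pt_op _ (pt_op _ _ _) _ in eA.
  set r := pt_op _ _ _ in eA.
  have -> : conv (co_op M) (conv (co_op M) f g) h = sup_comp L l.
    suff e : sup_comp Delta (tensor_map (conv (co_op M) f g) h) =
      sup_comp L (copair (pt_op (co_op M) (pr1 R) (pr2 R)) (pr3 R)).
      apply: sup_hom_eq => x.
      exact: (f_equal (fun k : SupHom (tensor R R) Omega => k (co_op M x)) e).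
    apply: tensor_hom_eq => a b; rewrite !sup_compE tensor_map_pure Delta_pure.
    rewrite copair_pure.
    have -> : pt_op (co_op M) (pr1 R) (pr2 R) a = inl (coprod R R) R (co_op M a).
      rewrite /pt_op; suff -> : copair (pr1 R) (pr2 R) = inl (coprod R R) R by [].
      by apply: coprod_hom_eq; rewrite ?copair_inl ?copair_inr.
    by rewrite inl_mul_inr tensor_map_pure Delta_pure.
  have -> : conv (co_op M) f (conv (co_op M) g h) = sup_comp L r.
    suff e : sup_comp Delta (tensor_map f (conv (co_op M) g h)) =
      sup_comp L (copair (pr1 R) (pt_op (co_op M) (pr2 R) (pr3 R))).
      apply: sup_hom_eq => x.
      exact: (f_equal (fun k : SupHom (tensor R R) Omega => k (co_op M x)) e).
    apply: tensor_hom_eq => a b; rewrite !sup_compE tensor_map_pure Delta_pure.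
    rewrite copair_pure /pt_op q_compE /conv !sup_compE.
    move: (co_op M b : tensor R R) => D.
    suff e : sup_comp (@mul_hom Omega_frame (f a)) (sup_comp Delta (tensor_map g h)) =
             sup_comp L (sup_comp (mul_hom (pr1 R a)) (copair (pr2 R) (pr3 R))).
      change (sup_comp (@mul_hom Omega_frame (f a)) (sup_comp Delta (tensor_map g h)) D =
        sup_comp L (sup_comp (mul_hom (pr1 R a)) (copair (pr2 R) (pr3 R))) D).
      by rewrite e.
    apply: tensor_hom_eq => b1 b2; rewrite !sup_compE tensor_map_pure Delta_pure.
    rewrite copair_pure.
    change ((f a /\ g b1 /\ h b2) = L (mul (pr1 R a) (mul (pr2 R b1) (pr3 R b2)))).
    rewrite mulA /pr1 /pr2 /pr3 !q_compE -q_hom_mul !inl_mul_inr eL.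
    by apply: propositional_extensionality; tauto.
  by rewrite eA.
- move=> f g; pose sw := copair (inr R R) (inl R R).
  have hM : forall x, sw (co_op M x) = co_op M x.
    move=> x; change (pt_op (co_op M) (inr R R) (inl R R) x = co_op M x).
    rewrite co_comm /pt_op.
    suff -> : copair (inl R R) (inr R R) = q_id (coprod R R) by [].
    by apply: coprod_hom_eq; rewrite ?copair_inl ?copair_inr; apply: q_hom_eq.
  have e : sup_comp Delta (tensor_map f g) = sup_comp (sup_comp Delta (tensor_map g f)) sw.
    apply: tensor_hom_eq => a b; rewrite !sup_compE copair_pure mulC inl_mul_inr.
    rewrite !tensor_map_pure !Delta_pure.
    by apply: propositional_extensionality; tauto.
  apply: sup_hom_eq => x.
  change (sup_comp Delta (tensor_map f g) (co_op M x) =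
          sup_comp Delta (tensor_map g f) (co_op M x)).
  rewrite e; exact: (f_equal (sup_comp Delta (tensor_map g f)) (hM x)).
- move=> g; apply: sup_hom_eq => x.
  have e : sup_comp Delta (tensor_map (co_unit M) g) =
           sup_comp g (copair (pt_const R (co_unit M)) (q_id R)).
    apply: tensor_hom_eq => a b; rewrite !sup_compE copair_pure tensor_map_pure Delta_pure.
    have -> : mul (pt_const R (co_unit M) a) (q_id R b) = scale R (co_unit M a) b.
      rewrite mulC; apply: eq_trans (mul_sup _ _) _; apply: sup_ext => y; split.
        by move=> [_ [hp ->] ->]; rewrite mulC fr_top_mul.
      by move=> [hp ->]; exists top => //; rewrite mulC fr_top_mul.
    apply: propositional_extensionality.
    change (co_unit M a /\ g b <-> g (sup (fun y => co_unit M a /\ y = b))).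
    rewrite sup_fun_sup; split; last by move=> [_ [_ [hp ->] ->]].
    by move=> [hp gb]; exists (g b) => //; exists b.
  change (sup_comp Delta (tensor_map (co_unit M) g) (co_op M x) = g x).
  rewrite e; congr (g _).
  exact: (f_equal (fun k : FrameHom R R => k x) (co_neutral M)).
- move=> f G; apply: sup_hom_eq => x; apply: propositional_extensionality.
  apply: iff_trans (Delta_map _ _ _) _; split.
  + move=> [a [b [Dab [fa [_ [g Gg ->] gb]]]]].
    exists (conv (co_op M) f g x).
      by exists (conv (co_op M) f g) => //; exists g.
    by apply/Delta_map; exists a, b.
  + move=> [_ [_ [g Gg ->] ->] /Delta_map [a [b [Dab [fa gb]]]]].
    exists a, b; split=> //; split=> //.
    by exists (g b) => //; exists g.
Defined.

Definition add_quantale (R : LocSemiring) : Quantale := conv_quantale (sr_add R).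
Definition mul_quantale (R : LocSemiring) : Quantale := conv_quantale (sr_mul R).

Definition wc_zero (R : LocSemiring) : hom R Omega := (one : add_quantale R).
Definition wc_add (R : LocSemiring) (f g : hom R Omega) : hom R Omega :=
  @mul (add_quantale R) f g.

Lemma mul_top_infl (Q : Quantale) (W : Q) : W <= mul W top.
Proof.
rewrite -{1}(mul1 W) mulC.
by apply: mul_mono; [apply: le_refl|apply: top_ub].
Qed.

Lemma top_mul_top (Q : Quantale) : mul top top = (top : Q).
Proof. by apply: le_anti; [apply: top_ub|apply: mul_top_infl]. Qed.

Definition monoid_ideal_nucleus (R : LocSemiring) : Nucleus (mul_quantale R).
Proof.
refine {| nuc := fun W : mul_quantale R => mul W top |}.
- by move=> a b h; apply: mul_mono => //; apply: le_refl.
- exact: mul_top_infl.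
- by move=> a; rewrite -mulA top_mul_top.
- move=> a b; apply: le_eq; rewrite -{3}top_mul_top -!mulA; congr mul.
  by rewrite !mulA [mul top b]mulC.
Defined.

Definition MR (R : LocSemiring) : Quantale := nuc_quot (monoid_ideal_nucleus R).

Lemma MR_sup (R : LocSemiring) (S : MR R -> Prop) :
  proj1_sig (sup S) = sup (image (@proj1_sig _ _) S) :> mul_quantale R.
Proof.
set T := image _ S.
have -> : proj1_sig (sup S) = mul (sup T : mul_quantale R) top by [].
rewrite mulC mul_sup; apply: sup_ext => x; split.
- move=> [_ [a Sa ->] ->]; exists a => //.
  by rewrite mulC; apply: (proj2_sig a).
- move=> [a Sa ->]; exists (proj1_sig a); first by exists a.
  by rewrite mulC; symmetry; apply: (proj2_sig a).
Qed.

(** An inequality [x <= y] is imposed as the identification of [join x y] with [y]. *)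
Inductive ideal_rel (R : LocSemiring) : mul_quantale R -> mul_quantale R -> Prop :=
| ideal_rel_one : ideal_rel (R := R) one top
| ideal_rel_zero : ideal_rel (wc_zero R) bot
| ideal_rel_add a b : ideal_rel (join (wc_add a b) (join a b)) (join a b).

Definition Idl (R : LocSemiring) : Quantale := cong_quot (@ideal_rel R).
Definition idl_proj (R : LocSemiring) : QuantaleHom (mul_quantale R) (Idl R) :=
  cong_proj (@ideal_rel R).

Lemma idl_proj_nucleus (R : LocSemiring) (W : mul_quantale R) :
  idl_proj R (monoid_ideal_nucleus R W) = idl_proj R W.
Proof.
rewrite q_hom_mul.
have <- : idl_proj R one = idl_proj R top.
  apply: (proj2 (cong_proj_eq _ _ _)); apply: cong_gen_of; constructor.
by rewrite -q_hom_mul mulC mul1.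
Qed.

Definition MR_to_Idl (R : LocSemiring) : QuantaleHom (MR R) (Idl R) :=
  nuc_factor (@idl_proj_nucleus R).

Lemma Idl_two_sided (R : LocSemiring) : two_sided (Idl R).
Proof.
rewrite /two_sided -(q_hom_one (idl_proj R)).
have -> : idl_proj R one = idl_proj R top.
  apply: (proj2 (cong_proj_eq _ _ _)); apply: cong_gen_of; constructor.
apply: le_anti; first exact: top_ub.
apply/sup_le => x _; rewrite -(cong_proj_surj x).
by apply: hom_mono; apply: top_ub.
Qed.

Definition Rad (R : LocSemiring) : Frame := localic_reflection (@Idl_two_sided R).
Definition Idl_to_Rad (R : LocSemiring) : QuantaleHom (Idl R) (Rad R) :=
  reflection_unit (@Idl_two_sided R).

Definition saturated (R : LocSemiring) (s : R) : Prop :=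
  mu_mul R s <= inl R R s.

Lemma saturated_sup (R : LocSemiring) (S : R -> Prop) :
  (forall s, S s -> saturated s) -> saturated (sup S).
Proof.
move=> h; rewrite /saturated sup_fun_sup; apply/sup_le => _ [s Ss ->].
apply: le_trans (h s Ss) _; apply: hom_mono; exact: sup_ub.
Qed.

Definition SR (R : LocSemiring) : SupLat.
Proof.
unshelve refine {| sup_car := {s : R | saturated s};
  le := fun s t => proj1_sig s <= proj1_sig t;
  sup := fun S => exist _ (sup (image (@proj1_sig _ _) S)) _ |}.
- by apply: saturated_sup => _ [s _ ->]; apply: (proj2_sig s).
- by move=> s; apply: le_refl.
- by move=> s t u; apply: le_trans.
- by move=> s t h h'; apply/sig_ext/le_anti.
- move=> S t /=; rewrite sup_le; split.
  + by move=> h s Ss; apply: h; exists s.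
  + by move=> h _ [s Ss ->]; apply: h.
Defined.

Definition kappa (R : LocSemiring) : SupHom (SR R) R :=
  {| sup_fun := (@proj1_sig _ _ : SR R -> R); sup_fun_sup := fun S => eq_refl |}.

Definition eval_bihom (R : LocSemiring) : BiHom (SR R) (MR R) Omega.
Proof.
refine {| bi_fun := fun s (h : MR R) => (proj1_sig h : hom R Omega) (kappa R s) |}.
- move=> h; exact: comp_sup_preserving (sup_fun_sup (proj1_sig h : hom R Omega))
    (sup_fun_sup (kappa R)).
- move=> s S; rewrite MR_sup; apply: sup_ext => p; split.
  + by move=> [_ [h Sh ->] ->]; exists h.
  + by move=> [h Sh ->]; exists (proj1_sig h) => //; exists h.
Defined.

Definition eval (R : LocSemiring) : SupHom (tensor (SR R) (MR R)) Omega :=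
  tensor_lift (eval_bihom R).

Record Presheaf := {
  psh :> Locale -> Type;
  psh_map : forall Y X : Locale, LocMap Y X -> psh X -> psh Y;
  psh_map_id : forall (X : Locale) (x : psh X), psh_map (loc_id X) x = x;
  psh_map_comp : forall (Z Y X : Locale) (f : LocMap Y X) (g : LocMap Z Y) (x : psh X),
    psh_map (loc_comp f g) x = psh_map g (psh_map f x)
}.

Definition yoneda (L : Locale) : Presheaf.
Proof.
refine {| psh := fun X => LocMap X L;
          psh_map := fun Y X (f : LocMap Y X) (g : LocMap X L) => loc_comp g f |};
  by move=> *; apply: q_hom_eq.
Defined.

Record NatIso (F G : Presheaf) := {
  iso_fun :> forall X : Locale, F X -> G X;
  iso_inv : forall X : Locale, G X -> F X;
  iso_nat : forall (Y X : Locale) (f : LocMap Y X) (x : F X),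
    iso_fun (psh_map f x) = psh_map f (iso_fun x);
  iso_funK : forall (X : Locale) (x : F X), iso_inv (iso_fun x) = x;
  iso_invK : forall (X : Locale) (y : G X), iso_fun (iso_inv y) = y
}.

Definition represented_by (F : Presheaf) (L : Locale) (u : F L) : Prop :=
  exists phi : NatIso (yoneda L) F, phi L (loc_id L) = u.

Record is_opai (R : LocSemiring) (X : Locale) (u : coprod X R) : Prop := {
  opai_zero : coprod_map (q_id X) (eps0 R) u = bot;
  opai_one : coprod_map (q_id X) (eps1 R) u = top;
  opai_add : coprod_map (q_id X) (mu_add R) u <=
    join (coprod_map (q_id X) (inl R R) u) (coprod_map (q_id X) (inr R R) u);
  opai_mul : coprod_map (q_id X) (mu_mul R) u =
    meet (coprod_map (q_id X) (inl R R) u) (coprod_map (q_id X) (inr R R) u)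
}.

Lemma coprod_map_swap (X Y A B : Frame) (f : FrameHom X Y) (g : FrameHom A B) u :
  coprod_map (q_id Y) g (coprod_map f (q_id A) u) =
  coprod_map f (q_id B) (coprod_map (q_id X) g u).
Proof.
change (sup_comp (tensor_map (q_id Y) g) (tensor_map f (q_id A)) u =
        sup_comp (tensor_map f (q_id B)) (tensor_map (q_id X) g) u).
rewrite !tensor_map_comp; congr (tensor_map _ _ u); exact: sup_hom_eq.
Qed.

Lemma is_opai_map (R : LocSemiring) (Y X : Locale) (f : LocMap Y X) (u : coprod X R) :
  is_opai u -> is_opai (coprod_map f (q_id R) u).
Proof.
move=> [h0 h1 ha hm]; split; rewrite !coprod_map_swap.
- by rewrite h0 hom_bot.
- by rewrite h1 fr_hom_top.
- by rewrite -hom_join; apply: hom_mono.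
- by rewrite hm /meet q_hom_mul.
Qed.

Definition OPAI (R : LocSemiring) : Presheaf.
Proof.
unshelve refine {| psh := fun X => {u : coprod X R | is_opai u};
  psh_map := fun Y X (f : LocMap Y X) u =>
    exist _ (coprod_map f (q_id R) (proj1_sig u)) _ |}.
- exact: is_opai_map (proj2_sig u).
- move=> X u; apply: sig_ext => /=.
  change (tensor_map (sup_id X) (sup_id R) (proj1_sig u) = proj1_sig u).
  by rewrite tensor_map_id.
- move=> Z Y X f g u; apply: sig_ext => /=.
  change (tensor_map (sup_comp g f) (sup_id R) (proj1_sig u) =
    sup_comp (tensor_map g (sup_id R)) (tensor_map f (sup_id R)) (proj1_sig u)).
  rewrite tensor_map_comp; congr (tensor_map _ _ _); exact: sup_hom_eq.
Defined.

(* Main.v *)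
(** When [R] is overt, existential quantification along the projection [R * R -> R]
    turns [s |-> mu_mul R s] into a closure operator [sat_hom] on [R] whose fixed points
    are the saturated opens; hence [MR R] is [hom (SR R) Omega], and the unit of the
    duality is the bi-ideal of those [(h, s)] such that [h s'] implies [s <= s'].
    An open [v] of [X * R] acts on functionals by [f |-> (X (x) f) v], and when [v] is
    fixed by [X (x) sat_hom] dualisability makes this action determine [v].
    The four axioms of an OPAI then say that the action is a quantale homomorphism
    [hom R Omega -> X] compatible with the relations defining [Idl R], i.e. a frame
    homomorphism [Rad R -> X]; the universal element is the one acting by the
    quotient map [hom R Omega -> Rad R]. *)
From Corelib Require Import ssreflect.
From Stdlib Require Import PropExtensionality.
Require Import Defs.

Set Implicit Arguments.
Unset Strict Implicit.
Unset Printing Implicit Defensive.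

(** * Testing on pure tensors; scaling by truth values *)

Lemma tensor_hom_le (A B C : SupLat) (F : SupHom (tensor A B) C) (D : tensor A B) c :
  F D <= c <-> forall a b, pure a b <= D -> F (pure a b) <= c.
Proof.
split=> [h a b hab|h]; first exact: le_trans (hom_mono F hab) h.
rewrite (tensor_gen D) sup_fun_sup; apply/sup_le => _ [_ [a [b [Dab ->]]] ->].
by apply: h; apply/pure_le.
Qed.

Lemma tensor_hom_le2 (A B C C' : SupLat) (F : SupHom (tensor A (tensor B C)) C') D c :
  (forall x a b, pure x (pure a b) <= D -> F (pure x (pure a b)) <= c) -> F D <= c.
Proof.
move=> h; apply/tensor_hom_le => x d hd.
apply/(tensor_hom_le (sup_comp F (pure_l (tensor B C) x)) d c) => a b hab.
apply: h; apply: le_trans hd; exact: (hom_mono (pure_l (tensor B C) x) hab).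
Qed.

Lemma pure_mono (A B : SupLat) (a a' : A) (b b' : B) :
  a <= a' -> b <= b' -> pure a b <= pure a' b'.
Proof.
move=> ha hb; apply: le_trans (hom_mono (pure_r A b) ha) _.
exact: (hom_mono (pure_l B a') hb).
Qed.

Lemma tensor_map_mono (A B A' B' : SupLat) (f f' : SupHom A A') (g g' : SupHom B B') D :
  (forall a, f a <= f' a) -> (forall b, g b <= g' b) ->
  tensor_map f g D <= tensor_map f' g' D.
Proof.
move=> hf hg; apply/tensor_hom_le => a b hab.
by apply: le_trans (hom_mono _ hab); rewrite !tensor_map_pure; apply: pure_mono.
Qed.

Lemma tensor_map_compE (A B A' B' A'' B'' : SupLat)
  (f' : SupHom A' A'') (f : SupHom A A') (g' : SupHom B' B'') (g : SupHom B B') D :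
  tensor_map f' g' (tensor_map f g D) = tensor_map (sup_comp f' f) (sup_comp g' g) D.
Proof. by rewrite -tensor_map_comp. Qed.

Lemma scale_le (A : SupLat) (p : Prop) (a b : A) : scale A p a <= b <-> (p -> a <= b).
Proof. exact: scale_adj. Qed.

Lemma le_scale (A : SupLat) (p : Prop) (a : A) : p -> a <= scale A p a.
Proof. by move=> hp; apply: (proj1 (scale_le p a _) (le_refl _)). Qed.

Lemma hom_scale (A B : SupLat) (F : SupHom A B) (p : Prop) (a : A) :
  F (scale A p a) = scale B p (F a).
Proof.
rewrite /= sup_fun_sup; apply: sup_ext => y; split; last by move=> [hp ->]; exists a.
by move=> [_ [hp ->] ->].
Qed.

(** * Contraction of a tensor against a functional *)

(** This is $X\otimes f$ followed by $X\otimes\Omega\cong X$. When [f] is the frame map of a point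
    of a locale, it restricts opens of the product to that point. *)
Definition contract (X A : SupLat) (f : SupHom A Omega) : SupHom (tensor X A) X :=
  sup_comp (runit X) (tensor_map (sup_id X) f).

Lemma contract_pure (X A : SupLat) (f : SupHom A Omega) (x : X) (a : A) :
  contract X f (pure x a) = scale X (f a) x.
Proof. by rewrite /contract sup_compE tensor_map_pure /runit tensor_lift_pure. Qed.

Lemma contract_le (X A : SupLat) (f : SupHom A Omega) (D : tensor X A) c :
  contract X f D <= c <-> forall x a, pure x a <= D -> f a -> x <= c.
Proof.
apply: iff_trans (tensor_hom_le _ _ _) _.
by split=> h x a hxa; move: (h x a hxa); rewrite contract_pure => /scale_le.
Qed.

Lemma le_contract (X A : SupLat) (f : SupHom A Omega) (D : tensor X A) x a :
  pure x a <= D -> f a -> x <= contract X f D.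
Proof. exact: (proj1 (contract_le f D _) (le_refl _)). Qed.

Lemma contract_tensor_map (X A B : SupLat) (f : SupHom B Omega) (g : SupHom A B) D :
  contract X f (tensor_map (sup_id X) g D) = contract X (sup_comp f g) D.
Proof. by rewrite /contract sup_compE tensor_map_compE. Qed.

Lemma contract_natural (X Y A B : SupLat) (k : SupHom X Y) (f : SupHom B Omega)
  (g : SupHom A B) D :
  contract Y f (tensor_map k g D) = k (contract X (sup_comp f g) D).
Proof.
suff e : sup_comp (contract Y f) (tensor_map k g) = sup_comp k (contract X (sup_comp f g)).
  exact: (f_equal (fun F : SupHom _ _ => F D) e).
apply: tensor_hom_eq => x a; rewrite [LHS]sup_compE [RHS]sup_compE.
by rewrite tensor_map_pure !contract_pure hom_scale.
Qed.

Lemma contract_sup (X A : SupLat) (D : tensor X A) :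
  sup_preserving (fun f : hom A Omega => contract X f D).
Proof.
move=> F; apply: le_char => c; rewrite contract_le sup_le; split.
- move=> h _ [f Ff ->]; apply/contract_le => x a hxa fa; apply: h hxa _.
  by exists (f a) => //; exists f.
- move=> h x a hxa [_ [f Ff ->] fa].
  by apply: le_trans (le_contract hxa fa) _; apply: h; exists f.
Qed.

(** $\Omega$ is the free suplattice on one generator: [p] is the join of the set that contains
    [True] exactly when [p] holds. *)
Lemma hom_Omega_scale (A : SupLat) (f : SupHom Omega A) (p : Prop) :
  f p = scale A p (f True).
Proof.
have e : (p : Omega) = sup (fun q : Omega => p /\ q = True).
  apply: propositional_extensionality; split; first by exists True.
  by move=> [_ [hp _] _].
rewrite {1}e sup_fun_sup; apply: sup_ext => y; split; last by move=> [hp ->]; exists True.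
by move=> [_ [hp ->] ->].
Qed.

Lemma Omega_top : (top : Omega) = True.
Proof. by apply: propositional_extensionality; split=> // _; exists True. Qed.

Lemma runit_top (X : SupLat) (D : tensor X Omega) : pure (runit X D) (True : Omega) = D.
Proof.
suff e : sup_comp (runit_inv X) (runit X) = sup_id (tensor X Omega).
  exact: (f_equal (fun F : SupHom _ _ => F D) e).
apply: tensor_hom_eq => x p; rewrite !sup_compE /runit tensor_lift_pure.
apply: eq_trans (hom_scale (pure_r X (True : Omega)) p x) _.
exact: eq_sym (hom_Omega_scale (pure_l Omega x) p).
Qed.

(** * Dualities in terms of pure tensors *)

(** Evaluated on pure tensors, the triangle identities become dual-basis expansions: every element
    is a join of components of the unit. *)
Lemma duality_pure (S D : SupLat) (ev : SupHom (tensor S D) Omega)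
  (eta : SupHom Omega (tensor D S)) :
  is_duality ev eta <->
  (forall s c, s <= c <-> forall a b, pure a b <= eta True -> ev (pure s a) -> b <= c) /\
  (forall d c, d <= c <-> forall a b, pure a b <= eta True -> ev (pure b d) -> a <= c).
Proof.
have e1 : forall s c,
  sup_comp (lunit S) (sup_comp (tensor_map ev (sup_id S))
    (sup_comp (assoc_inv S D S) (sup_comp (tensor_map (sup_id S) eta) (runit_inv S)))) s <= c
  <-> forall a b, pure a b <= eta True -> ev (pure s a) -> b <= c.
  move=> s c; rewrite 2![sup_comp _ _ s]sup_compE.
  have -> : sup_comp (assoc_inv S D S) (sup_comp (tensor_map (sup_id S) eta) (runit_inv S)) s
      = tensor_map (pure_l D s) (sup_id S) (eta True).
    apply: eq_trans (f_equal (assoc_inv S D S) (tensor_map_pure _ _ _ _)) _.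
    exact: tensor_lift_pure.
  apply: iff_trans (tensor_hom_le (sup_comp (sup_comp (lunit S)
    (tensor_map ev (sup_id S))) (tensor_map (pure_l D s) (sup_id S))) _ _) _.
  split=> h a b hab; move: (h a b hab);
    rewrite !sup_compE !tensor_map_pure /lunit tensor_lift_pure; by move/scale_le.
have e2 : forall d c,
  sup_comp (runit D) (sup_comp (tensor_map (sup_id D) ev)
    (sup_comp (assoc D S D) (sup_comp (tensor_map eta (sup_id D)) (lunit_inv D)))) d <= c
  <-> forall a b, pure a b <= eta True -> ev (pure b d) -> a <= c.
  move=> d c; rewrite 2![sup_comp _ _ d]sup_compE.
  have -> : sup_comp (assoc D S D) (sup_comp (tensor_map eta (sup_id D)) (lunit_inv D)) d
      = tensor_map (sup_id D) (pure_r S d) (eta True).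
    apply: eq_trans (f_equal (assoc D S D) (tensor_map_pure _ _ _ _)) _.
    exact: tensor_lift_pure.
  apply: iff_trans (tensor_hom_le (sup_comp (sup_comp (runit D)
    (tensor_map (sup_id D) ev)) (tensor_map (sup_id D) (pure_r S d))) _ _) _.
  split=> h a b hab; move: (h a b hab);
    rewrite !sup_compE !tensor_map_pure /runit tensor_lift_pure; by move/scale_le.
split=> [[h1 h2]|[h1 h2]]; split.
- by move=> s c; rewrite -e1 h1.
- by move=> d c; rewrite -e2 h2.
- by apply: sup_hom_eq => s; apply: le_char => c; rewrite e1 -h1.
- by apply: sup_hom_eq => d; apply: le_char => c; rewrite e2 -h2.
Qed.

Lemma duality_unique (S D : SupLat) (ev : SupHom (tensor S D) Omega)
  (eta eta' : SupHom Omega (tensor D S)) :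
  is_duality ev eta -> is_duality ev eta' -> eta = eta'.
Proof.
suff h : forall k k', is_duality ev k -> is_duality ev k' -> k True <= k' True.
  move=> h1 h2; apply: sup_hom_eq => p; rewrite !(hom_Omega_scale _ p).
  by congr (scale _ _ _); apply: le_anti; apply: h.
move=> k k' /duality_pure [_ h2] /duality_pure [h1 _]; apply/(tensor_hom_le (sup_id _)) => a b hab.
suff hb : b <= sup (fun b' => pure a b' <= k' True).
  apply: le_trans (hom_mono (pure_l S a) hb) _; rewrite sup_fun_sup.
  by apply/sup_le => _ [b' hb' ->].
(* The first identity for [k'] expands [b]; the second one for [k], applied to [a'], will give
   [a <= a']. *)
apply/h1 => a' b' hab' hev; apply: sup_ub; apply: le_trans hab'.
apply: pure_mono; last exact: le_refl.
exact: (proj1 (h2 a' a') (le_refl _) a b hab hev).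
Qed.

(** * Positivity and overtness *)

Lemma positive_le (A : SupLat) (a b : A) : a <= b -> positive a -> positive b.
Proof. by move=> hab ha I hI; apply: ha; apply: le_trans hab hI. Qed.

Lemma Omega_hom_positive (A : SupLat) (f : SupHom A Omega) a : f a -> positive a.
Proof.
by move=> fa I hI; move: (hom_mono f hI fa); rewrite sup_fun_sup => -[_ [x Ix _] _]; exists x.
Qed.

(** A base element below [a] is positive and so makes [a] positive; hence positivity of the left
    side may be assumed when proving an inequality. *)
Lemma overt_le (X : Locale) (hX : overt X) (a c : X) :
  (positive a -> a <= c) -> a <= c.
Proof.
case: hX => B [hB gen] h; rewrite {1}(gen a); apply/sup_le => b [Bb hba].
apply: (le_trans hba); apply: h; exact: positive_le hba (hB b Bb).
Qed.

Lemma positive_sup (X : Locale) (hX : overt X) :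
  @sup_preserving X Omega (@positive X).
Proof.
move=> S; apply: propositional_extensionality; split.
- case: (hX) => B [hB gen] pS.
  (* Positivity yields a member of any cover, so the cover is made of base elements that remember an
     element of [S] above them. *)
  have [|b [Bb [s Ss hbs]]] := pS (fun b => B b /\ exists2 s, S s & b <= s).
    apply/sup_le => s Ss; rewrite {1}(gen s); apply/sup_le => b [Bb hbs].
    by apply: sup_ub; split=> //; exists s.
  by exists (positive s); [exists s|apply: positive_le hbs (hB b Bb)].
- by move=> [_ [s Ss ->] ps]; apply: positive_le ps; apply: sup_ub.
Qed.

Definition pos_hom (X : Locale) (hX : overt X) : SupHom X Omega :=
  {| sup_fun := @positive X : X -> Omega; sup_fun_sup := positive_sup hX |}.

(** Contraction with positivity is existential quantification along the projection $X\times A\to X$,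
    left adjoint to pullback. By overtness only the [pure x a] with [a] positive matter. *)
Lemma contract_pos_le (X A : Frame) (hA : overt A) (D : tensor X A) c :
  contract X (pos_hom hA) D <= c <-> D <= inl X A c.
Proof.
split=> h.
- apply/(tensor_hom_le (sup_id _)) => x a hxa.
  have ha : a <= sup (fun b => b = a /\ positive a).
    by apply: (overt_le hA) => pa; apply: sup_ub.
  apply: le_trans (hom_mono (pure_l A x) ha) _; rewrite sup_fun_sup.
  apply/sup_le => _ [_ [-> pa] ->].
  apply: pure_mono (top_ub a); apply: le_trans h; exact: (le_contract (f := pos_hom hA) hxa pa).
- apply: le_trans (hom_mono _ h) _.
  apply: le_trans (le_eq (contract_pure (pos_hom hA) c top)) _.
  by apply/scale_le => _; apply: le_refl.
Qed.

(** * Calculus of generalised points *)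

(** Change of stage: through it, the laws imposed on generic points pass to all generalised
    points. *)
Lemma pt_op_comp (R X Y : Frame) (mu : FrameHom R (coprod R R)) (k : FrameHom X Y)
  (p q : FrameHom R X) :
  q_comp k (pt_op mu p q) = pt_op mu (q_comp k p) (q_comp k q).
Proof.
rewrite /pt_op; have -> : copair (q_comp k p) (q_comp k q) = q_comp k (copair p q).
  by apply: coprod_hom_eq; rewrite ?copair_inl ?copair_inr;
    apply: q_hom_eq => x; rewrite !q_compE -?(q_compE (copair p q)) ?copair_inl ?copair_inr.
exact: q_hom_eq.
Qed.

Section PointMonoid.
Variables (R X : Frame) (M : LocCMonoid R).
Implicit Types p q r : FrameHom R X.

Lemma pt_opC p q : pt_op (co_op M) p q = pt_op (co_op M) q p.
Proof.
have := f_equal (q_comp (copair q p)) (co_comm M).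
by rewrite !pt_op_comp !copair_inl !copair_inr.
Qed.

Lemma pt_opA p q r :
  pt_op (co_op M) p (pt_op (co_op M) q r) = pt_op (co_op M) (pt_op (co_op M) p q) r.
Proof.
(* [k] classifies the triple [p], [q], [r]; the generic law is pulled back along it. *)
pose k := copair (copair p q) r.
have e1 : q_comp k (pr1 R) = p.
  rewrite -(copair_inl p q) -[in RHS](copair_inl (copair p q) r); exact: q_hom_eq.
have e2 : q_comp k (pr2 R) = q.
  rewrite -[RHS](copair_inr p q) -[in RHS](copair_inl (copair p q) r); exact: q_hom_eq.
have e3 : q_comp k (pr3 R) = r by apply: copair_inr.
by have := f_equal (q_comp k) (co_assoc M); rewrite !pt_op_comp e1 e2 e3.
Qed.
End PointMonoid.

Lemma pt_op_unit (R X : Frame) (M : LocCMonoid R) (p : FrameHom R X) :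
  pt_op (co_op M) (pt_const X (co_unit M)) p = p.
Proof.
have := f_equal (q_comp p) (co_neutral M); rewrite pt_op_comp.
have -> : q_comp p (q_id R) = p by apply: q_hom_eq.
suff -> : q_comp p (pt_const R (co_unit M)) = pt_const X (co_unit M) by [].
apply: q_hom_eq => x.
by rewrite !q_compE [LHS](hom_scale p) fr_hom_top.
Qed.

Lemma pt_op_inl_inr (R : Frame) (mu : FrameHom R (coprod R R)) :
  pt_op mu (inl R R) (inr R R) = mu.
Proof.
rewrite /pt_op; have -> : copair (inl R R) (inr R R) = q_id (coprod R R).
  by apply: coprod_hom_eq; rewrite ?copair_inl ?copair_inr; apply: q_hom_eq.
exact: q_hom_eq.
Qed.

(** * Saturation as a closure operator, and monoid ideals *)

Section Saturation.
Variables (R : LocSemiring) (hR : overt R).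
Let mu := co_op (sr_mul R).


(** The hypothesis says that a product [x * y] in [u] forces [x] in [c] for the generic pair; this
    is its instance at [p], [q]. *)
Lemma mul_le_pt (X : Frame) (p q : FrameHom R X) (u c : R) :
  mu u <= inl R R c -> pt_op mu p q u <= p c.
Proof.
move=> /(hom_mono (copair p q)) h; apply: le_trans h (le_eq _).
by rewrite -[in RHS](copair_inl p q).
Qed.

(** In terms of points: those [x] for which some product [x * y] lies in [u]. *)
Definition sat_hom : SupHom R R := sup_comp (contract R (pos_hom hR)) mu.

Lemma sat_le (u c : R) : sat_hom u <= c <-> mu u <= inl R R c.
Proof. exact: contract_pos_le. Qed.

Lemma mul_le_sat (u : R) : mu u <= inl R R (sat_hom u).
Proof. by apply/sat_le; apply: le_refl. Qed.

Lemma sat_infl (u : R) : u <= sat_hom u.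
Proof.
(* The witness is [y = 1]. *)
have := mul_le_pt (q_id R) (pt_const R (eps1 R)) (@mul_le_sat u).
by rewrite pt_opC pt_op_unit.
Qed.

Lemma sat_fix (s : R) : saturated s -> sat_hom s = s.
Proof. by move=> hs; apply: le_anti (sat_infl s); apply/sat_le. Qed.

Lemma coprod_map_mul (A B : Frame) (f : FrameHom R A) (g : FrameHom R B) u :
  tensor_map f g (mu u) = pt_op mu (q_comp (inl A B) f) (q_comp (inr A B) g) u.
Proof. by rewrite tensor_map_copair. Qed.

Lemma coprod_map_mul_mul u :
  tensor_map mu (sup_id R) (mu u) = pt_op mu (pt_op mu (pr1 R) (pr2 R)) (pr3 R) u.
Proof.
rewrite [LHS](coprod_map_mul mu (q_id R)) -pt_op_comp pt_op_inl_inr.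
by have -> : q_comp (inr (coprod R R) R) (q_id R) = pr3 R by apply: q_hom_eq.
Qed.

(** By naturality of contraction, [x * y] lies in [sat_hom u] when some [(x * y) * z] lies in [u];
    reassociating, [y * z] witnesses that [x] lies in [sat_hom u]. *)
Lemma sat_saturated (u : R) : saturated (sat_hom u).
Proof.
rewrite /saturated.
have -> : mu_mul R (sat_hom u) =
    contract (coprod R R) (pos_hom hR) (tensor_map mu (sup_id R) (mu u)).
  by rewrite contract_natural.
apply/contract_pos_le; rewrite coprod_map_mul_mul -pt_opA.
exact: (mul_le_pt (pr1 R) (pt_op mu (pr2 R) (pr3 R)) (@mul_le_sat u)).
Qed.

(* At generalised points, [(x * a) * y = (x * y) * a] lies in a saturated [s] only if
   [x * y] does. *)
Lemma sat_mul_l (s : R) : saturated s -> tensor_map sat_hom (sup_id R) (mu s) <= mu s.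
Proof.
move=> hs.
have h : tensor_map mu (sup_id R) (mu s) <= tensor_map (inl R R) (sup_id R) (mu s).
  rewrite coprod_map_mul_mul -pt_opA [pt_op mu (pr2 R) _]pt_opC pt_opA.
  rewrite [X in _ <= X](coprod_map_mul (inl R R) (q_id R)).
  have -> : q_comp (inr (coprod R R) R) (q_id R) = pr3 R by apply: q_hom_eq.
  exact: (mul_le_pt (pt_op mu (pr1 R) (pr3 R)) (pr2 R) hs).
apply: (le_trans (y := tensor_map (contract R (pos_hom hR)) (sup_id R)
  (tensor_map mu (sup_id R) (mu s)))).
  by rewrite tensor_map_compE; apply: le_refl.
apply: le_trans (hom_mono _ h) _; rewrite tensor_map_compE.
rewrite -[X in _ <= X]/(sup_id (tensor R R) (mu s)) -tensor_map_id.
apply: tensor_map_mono => b; last exact: le_refl.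
by rewrite sup_compE; apply/contract_pos_le; apply: le_refl.
Qed.

(** Commutativity makes [mu s] invariant under the swap, which exchanges this statement with the
    left-hand one. *)
Lemma sat_mul_r (s : R) : saturated s -> tensor_map (sup_id R) sat_hom (mu s) <= mu s.
Proof.
pose sw := copair (inr R R) (inl R R).
have sw_mu : sw (mu s) = mu s.
  rewrite -[LHS]/(pt_op mu (inr R R) (inl R R) s).
  by rewrite (co_comm (sr_mul R)) pt_op_inl_inr.
have sw_pure : forall a b, sw (pure a b) = pure b a.
  by move=> a b; rewrite copair_pure mulC inl_mul_inr.
have sw_map : sup_comp sw (tensor_map sat_hom (sup_id R)) =
    sup_comp (tensor_map (sup_id R) sat_hom) sw.
  apply: tensor_hom_eq => a b.
  by rewrite [LHS]sup_compE [RHS]sup_compE sw_pure !tensor_map_pure sw_pure.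
move=> hs; have := hom_mono sw (sat_mul_l hs).
rewrite -[X in X <= _ -> _]/(sup_comp sw (tensor_map sat_hom (sup_id R)) (mu s)).
by rewrite sw_map sup_compE sw_mu.
Qed.

Lemma sat_mul (s : R) : saturated s -> tensor_map sat_hom sat_hom (mu s) <= mu s.
Proof.
move=> hs; apply: le_trans (sat_mul_r hs).
apply: le_trans (hom_mono (tensor_map (sup_id R) sat_hom) (sat_mul_l hs)).
by rewrite tensor_map_compE; apply: le_refl.
Qed.

Definition sat : SupHom R (SR R).
Proof.
refine {| sup_fun := fun u => exist _ (sat_hom u) (@sat_saturated u) : SR R |}.
move=> S; apply: sig_ext; apply: eq_trans (sup_fun_sup sat_hom S) _.
apply: sup_ext => x; split; last by move=> [_ [u Su ->] ->]; exists u.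
by move=> [u Su ->]; exists (exist _ (sat_hom u) (@sat_saturated u)) => //; exists u.
Defined.

Lemma sat_kappa (s : SR R) : sat (kappa R s) = s.
Proof. by apply: sig_ext; apply: sat_fix; apply: (proj2_sig s). Qed.

(** Multiplying by [top] quantifies the second factor away. Monoid ideals are therefore the
    functionals that cannot tell an open from its saturation. *)
Lemma conv_top (f : mul_quantale R) (u : R) :
  (mul f top : hom R Omega) u = (f : hom R Omega) (sat_hom u).
Proof.
(* Positivity is the largest functional, since [g a] forces [a] to be positive. *)
have -> : (top : mul_quantale R) = pos_hom hR.
  apply: sup_hom_eq => a; apply: propositional_extensionality; split.
    by move=> [_ [g _ ->] ga]; apply: Omega_hom_positive ga.
  by move=> pa; exists (pos_hom hR a) => //; exists (pos_hom hR).
suff e : sup_comp Delta (tensor_map (f : hom R Omega) (pos_hom hR)) =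
    sup_comp (f : hom R Omega) (contract R (pos_hom hR)).
  exact: (f_equal (fun F : SupHom _ _ => F (mu u)) e).
apply: tensor_hom_eq => a b; rewrite [LHS]sup_compE [RHS]sup_compE.
rewrite tensor_map_pure Delta_pure contract_pure hom_scale.
apply: propositional_extensionality; split; last by move=> [_ [pb ->] fa].
by move=> [fa pb]; exists ((f : hom R Omega) a).
Qed.

Lemma MR_sat (h : MR R) (u : R) :
  (proj1_sig h : hom R Omega) (sat_hom u) = (proj1_sig h : hom R Omega) u.
Proof. by rewrite -conv_top; congr (sup_fun _ u); apply: (proj2_sig h). Qed.

(** The inverse of restriction along [kappa]; [MR_ofE] and [MR_le] complete the isomorphism of
    [MR R] with [hom (SR R) Omega]. *)
Definition MR_of (g : SupHom (SR R) Omega) : MR R.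
Proof.
exists (sup_comp g sat : mul_quantale R).
apply: sup_hom_eq => u; rewrite [LHS]conv_top !sup_compE; congr (g _).
exact: sat_kappa (sat u).
Defined.

Lemma MR_ofE g (s : SR R) : (proj1_sig (MR_of g) : hom R Omega) (kappa R s) = g s.
Proof. by rewrite [LHS]sup_compE sat_kappa. Qed.

Lemma MR_le (h h' : MR R) :
  (forall s, (proj1_sig h : hom R Omega) (kappa R s) ->
    (proj1_sig h' : hom R Omega) (kappa R s)) -> h <= h'.
Proof. by move=> hh u; rewrite -MR_sat -[X in _ <= X]MR_sat; apply: (hh (sat u)). Qed.
End Saturation.

(** * The canonical unit of the duality *)

(** The unit of the duality, as an element of [MR R (x) SR R]: it corresponds to the
    identity under the identification of the latter with [hom (SR R) (SR R)]. *)
Definition dual_unit (R : LocSemiring) : tensor (MR R) (SR R).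
Proof.
exists (fun (h : MR R) (s : SR R) =>
  forall s', (proj1_sig h : hom R Omega) (kappa R s') -> s <= s').
split=> [S s|h T].
- split=> [hS h Sh s' hs'|hS s'].
    apply: hS; have -> : (proj1_sig (sup S) : hom R Omega) (kappa R s') =
      eval_bihom R s' (sup S) by [].
    rewrite bi_fun_r; exists (eval_bihom R s' h) => //; exists h => //.
  rewrite -[X in X -> _]/(eval_bihom R s' (sup S)) bi_fun_r => -[_ [h Sh ->]].
  exact: hS.
- split=> [hT s Ts s' hs'|hT s' hs'].
    by apply: le_trans (hT s' hs'); apply: sup_ub.
  by apply/sup_le => s Ts; apply: hT.
Defined.

Lemma pure_le_dual_unit (R : LocSemiring) (h : MR R) (s : SR R) :
  pure h s <= dual_unit R <->
  forall s', (proj1_sig h : hom R Omega) (kappa R s') -> s <= s'.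
Proof. exact: pure_le. Qed.

Lemma dual_unit_sat (R : LocSemiring) (hR : overt R) (h : MR R) (s : SR R) (u : R) :
  pure h s <= dual_unit R -> (proj1_sig h : hom R Omega) u -> s <= sat hR u.
Proof. by move=> /pure_le_dual_unit hs hu; apply: hs; rewrite /= (MR_sat hR). Qed.

Definition duality_unit (R : LocSemiring) : SupHom Omega (tensor (MR R) (SR R)) :=
  {| sup_fun := fun p => scale (tensor (MR R) (SR R)) p (dual_unit R);
     sup_fun_sup := bi_fun_l (scale (tensor (MR R) (SR R))) (dual_unit R) |}.

Lemma duality_unit_True (R : LocSemiring) : duality_unit R True = dual_unit R.
Proof. by apply: le_anti; [apply/scale_le => _; apply: le_refl|apply: le_scale]. Qed.

(** The expansion of [s] over the given dual transfers to [dual_unit], because each [d] there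
    defines a monoid ideal through [ev]. The second identity follows by applying a monoid ideal to
    the expansion of [s]. *)
Lemma duality_unitP (R : LocSemiring) :
  overt R -> dualisable (SR R) -> is_duality (eval R) (duality_unit R).
Proof.
move=> hR [D [ev [k /duality_pure [h1 h2]]]]; apply/duality_pure.
rewrite duality_unit_True.
have eE : forall s h, eval R (pure s h) = (proj1_sig h : hom R Omega) (kappa R s).
  by move=> s h; rewrite /eval tensor_lift_pure.
have hs : forall s c, s <= c <->
    forall a b, pure a b <= dual_unit R -> eval R (pure s a) -> b <= c.
  move=> s c; split.
    move=> hsc a b /pure_le_dual_unit hab; rewrite eE => has.
    exact: le_trans (hab s has) hsc.
  move=> h; apply/h1 => d b hdb hsd.
  (* By the given first identity, [b] lies below every [s'] at which this functional holds, so
     [MR_of hR g] and [b] are related by [dual_unit]. *)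
  pose g : SupHom (SR R) Omega := sup_comp ev (pure_r (SR R) d).
  apply: (h (MR_of hR g) b); last by rewrite eE MR_ofE.
  apply/pure_le_dual_unit => s'; rewrite MR_ofE => hs'.
  exact: (proj1 (h1 s' s') (le_refl _) d b hdb hs').
split=> // d c; split.
- move=> hdc a b /pure_le_dual_unit hab; rewrite eE => hdb.
  apply: (MR_le hR) => s has; apply: (hdc).
  exact: (hom_mono (sup_comp (proj1_sig d : hom R Omega) (kappa R)) (hab s has) hdb).
- move=> h; apply: (MR_le hR) => s ds.
  have hle : s <= sup (fun b => exists2 a, pure a b <= dual_unit R & eval R (pure s a)).
    by apply/hs => a b hab has; apply: sup_ub; exists a.
  move: (hom_mono (sup_comp (proj1_sig d : hom R Omega) (kappa R)) hle ds).
  rewrite sup_fun_sup => -[_ [b [a hab has] ->] db].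
  by move: has; rewrite eE; apply: (h a b hab); rewrite eE.
Qed.

(** * Separation of saturated tensors by functionals *)

Definition pairing (R : SupLat) (f g : SupHom R Omega) : SupHom (tensor R R) Omega :=
  sup_comp Delta (tensor_map f g).

Lemma pairing_pure (R : SupLat) (f g : SupHom R Omega) a b :
  pairing f g (pure a b) = (f a /\ g b).
Proof. by rewrite /pairing sup_compE tensor_map_pure Delta_pure. Qed.

Section Separation.
Variables (R : LocSemiring) (hR : overt R) (dR : dualisable (SR R)).

(** The first triangle identity at [sat hR u], with the related pairs [h], [s] acting as a dual
    basis. *)
Lemma sat_le_dual_unit (A : SupLat) (F : SupHom R A) (u : R) (c : A) :
  (forall (h : MR R) (s : SR R), pure h s <= dual_unit R ->
    (proj1_sig h : hom R Omega) u -> F (kappa R s) <= c) ->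
  F (sat_hom hR u) <= c.
Proof.
move=> hc; have /duality_pure [h1 _] := duality_unitP hR dR.
have hle : sat hR u <= sup (fun s => F (kappa R s) <= c).
  apply/h1 => h s; rewrite duality_unit_True => hs.
  rewrite /eval tensor_lift_pure => hu; apply: sup_ub; apply: hc hs _.
  by rewrite -(MR_sat hR).
apply: le_trans (hom_mono (sup_comp F (kappa R)) hle) _; rewrite sup_fun_sup.
by apply/sup_le => _ [s hs ->].
Qed.

(** For [pure x r <= z], the saturation of [r] is a join of elements [s] related to some [h] with
    [h r]. Then [x] is below the action of [h] on [w], a join of [y] with [pure y c <= w] and [h c];
    and [h c] forces [s] below the saturation of [c]. *)
Lemma contract_separates (X : SupLat) (z w : tensor X R) :
  (forall f, contract X f z <= contract X f w) ->
  tensor_map (sup_id X) (sat_hom hR) z <= tensor_map (sup_id X) (sat_hom hR) w.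
Proof.
move=> hzw; set E := tensor_map _ _ w.
apply/tensor_hom_le => x r hxr; rewrite tensor_map_pure.
apply: (sat_le_dual_unit (F := pure_l R x)) => h s hs hr.
have hx : x <= sup (fun y => pure y (kappa R s) <= E).
  apply: le_trans (le_contract hxr hr) _; apply: le_trans (hzw _) _.
  apply/contract_le => y c hyc hc; apply: sup_ub.
  apply: le_trans (hom_mono (tensor_map _ _) hyc); rewrite tensor_map_pure.
  by apply: pure_mono (le_refl _) _; apply: (dual_unit_sat hR hs hc).
apply: le_trans (hom_mono (pure_r X (kappa R s)) hx) _; rewrite sup_fun_sup.
by apply/sup_le => _ [y hy ->].
Qed.

(** The preceding argument with the two copies of [R] expanded one after the other; hence
    functionals of product form suffice. *)
Lemma pairing_separates (X : SupLat) (z w : tensor X (tensor R R)) :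
  (forall f g, contract X (pairing f g) z <= contract X (pairing f g) w) ->
  tensor_map (sup_id X) (tensor_map (sat_hom hR) (sat_hom hR)) z <=
  tensor_map (sup_id X) (tensor_map (sat_hom hR) (sat_hom hR)) w.
Proof.
move=> hzw; set E := tensor_map _ _ w.
apply: tensor_hom_le2 => x r r' hxr; rewrite !tensor_map_pure.
apply: (sat_le_dual_unit
  (F := sup_comp (pure_l (tensor R R) x) (pure_r R (sat_hom hR r')))) => h s hs hr.
apply: (sat_le_dual_unit
  (F := sup_comp (pure_l (tensor R R) x) (pure_l R (kappa R s)))) => h' s' hs' hr'.
have hx : x <= sup (fun y => pure y (pure (kappa R s) (kappa R s')) <= E).
  apply: le_trans (le_contract (f := pairing (proj1_sig h : hom R Omega)
    (proj1_sig h' : hom R Omega)) hxr _) _; first by rewrite pairing_pure.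
  apply: le_trans (hzw _ _) _.
  apply: tensor_hom_le2 => y c c' hyc; rewrite contract_pure pairing_pure.
  apply/scale_le => -[hc hc']; apply: sup_ub.
  apply: le_trans (hom_mono (tensor_map _ _) hyc); rewrite !tensor_map_pure.
  apply: pure_mono (le_refl _) _.
  by apply: pure_mono; [apply: (dual_unit_sat hR hs hc)|apply: (dual_unit_sat hR hs' hc')].
apply: le_trans (hom_mono (pure_r X (pure (kappa R s) (kappa R s'))) hx) _.
by rewrite sup_fun_sup; apply/sup_le => _ [y hy ->].
Qed.
End Separation.

(** * From an OPAI to a frame homomorphism on [Rad R] *)

(** The two opens depend on different copies of [R]. One inequality comes from projecting to each;
    for the other, [pure x a] and [pure y b] combine to [pure (mul x y) (pure a b)]. *)
Lemma contract_meet (X R : Frame) (f g : SupHom R Omega) (v w : coprod X R) :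
  contract X (pairing f g)
    (meet (coprod_map (q_id X) (inl R R) v) (coprod_map (q_id X) (inr R R) w)) =
  meet (contract X f v) (contract X g w).
Proof.
apply: le_anti.
- apply/meet_glb; split.
  + apply: le_trans (hom_mono (contract X (pairing f g))
      (meet_lel (A := coprod X (coprod R R)) _ _)) _.
    apply: le_trans (le_eq (contract_tensor_map _ _ _)) _.
    apply/contract_le => x a hxa.
    rewrite -[X in X -> _]/(pairing f g (pure a top)) pairing_pure.
    by move=> [fa _]; apply: le_contract hxa fa.
  + apply: le_trans (hom_mono (contract X (pairing f g))
      (meet_ler (A := coprod X (coprod R R)) _ _)) _.
    apply: le_trans (le_eq (contract_tensor_map _ _ _)) _.
    apply/contract_le => x a hxa.
    rewrite -[X in X -> _]/(pairing f g (pure top a)) pairing_pure.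
    by move=> [_ ga]; apply: le_contract hxa ga.
- have hpure : forall x a y b, pure x a <= v -> pure y b <= w -> f a -> g b ->
      mul x y <= contract X (pairing f g)
        (meet (coprod_map (q_id X) (inl R R) v) (coprod_map (q_id X) (inr R R) w)).
  { move=> x a y b hv hw fa gb.
    apply: (le_contract (a := pure a b)); last by rewrite pairing_pure.
    apply: (proj2 (meet_glb (A := coprod X (coprod R R)) _ _ _)); split.
    + apply: le_trans (hom_mono _ hv); rewrite [X in _ <= X]tensor_map_pure.
      by apply: pure_mono (meet_lel _ _) _; apply: pure_mono (le_refl _) (top_ub _).
    + apply: le_trans (hom_mono _ hw); rewrite [X in _ <= X]tensor_map_pure.
      by apply: pure_mono (meet_ler _ _) _; apply: pure_mono (top_ub _) (le_refl _). }
  (* Multiplication preserves joins, so the two contractions can be tested on pure tensors in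
     turn. *)
  have swap : forall c (F : SupHom (tensor X R) X) z u,
      (forall x a, pure x a <= z -> mul u (F (pure x a)) <= c) -> mul u (F z) <= c.
    move=> c F z u h; exact: (proj2 (tensor_hom_le (sup_comp (mul_hom u) F) z c) h).
  apply: (swap _ (contract X g)) => y b hw; rewrite contract_pure.
  rewrite [X in X <= _](hom_scale (mul_hom (contract X f v))); apply/scale_le => gb.
  rewrite [mul_hom _ _]mulC.
  apply: (swap _ (contract X f)) => x a hv; rewrite contract_pure.
  rewrite [X in X <= _](hom_scale (mul_hom y)); apply/scale_le => fa.
  by rewrite [mul_hom _ _]mulC; apply: hpure hv hw fa gb.
Qed.

(** An explicit term, because the inverse in [NatIso] is data and the [exists!] of
    [cong_quot_universal] does not produce data. *)
Definition cong_lift (P Q : Quantale) (G : Q -> Q -> Prop) (f : QuantaleHom Q P)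
  (hG : forall x y, G x y -> f x = f y) : QuantaleHom (cong_quot G) P :=
  nuc_factor (j := cong_nucleus (cong_gen_cong G))
    (fun a => eq_sym (cong_class_sup (cong_gen_cong G) a _ (kernel_cong f) hG)).

Lemma cong_liftE (P Q : Quantale) (G : Q -> Q -> Prop) (f : QuantaleHom Q P)
  (hG : forall x y, G x y -> f x = f y) a : cong_lift hG (cong_proj G a) = f a.
Proof. exact: eq_sym (cong_class_sup (cong_gen_cong G) a _ (kernel_cong f) hG). Qed.

Section Universal.
Variable R : LocSemiring.

Definition rad_proj : QuantaleHom (mul_quantale R) (Rad R) :=
  q_comp (Idl_to_Rad R) (idl_proj R).

Lemma rad_proj_surj (x : Rad R) : exists W, rad_proj W = x.
Proof.
exists (proj1_sig (proj1_sig x)).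
by rewrite q_compE [idl_proj R _]cong_proj_surj [LHS]cong_proj_surj.
Qed.

Lemma rad_hom_eq (X : Frame) (k k' : FrameHom (Rad R) X) :
  (forall W, k (rad_proj W) = k' (rad_proj W)) -> k = k'.
Proof. by move=> h; apply: q_hom_eq => x; case: (rad_proj_surj x) => W <-. Qed.

Lemma rad_proj_zero : rad_proj (eps0 R : hom R Omega) = bot.
Proof.
rewrite q_compE; have -> : idl_proj R (eps0 R : hom R Omega) = idl_proj R bot.
  by apply: (proj2 (cong_proj_eq _ _ _)); apply: cong_gen_of; apply: ideal_rel_zero.
by rewrite !hom_bot.
Qed.

Lemma rad_proj_add (f g : mul_quantale R) :
  rad_proj (join (wc_add f g) (join f g)) = rad_proj (join f g).
Proof.
rewrite !q_compE; congr (Idl_to_Rad R _).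
by apply: (proj2 (cong_proj_eq _ _ _)); apply: cong_gen_of; apply: ideal_rel_add.
Qed.

Section OpaiHom.
Variables (X : Frame) (v : coprod X R) (hv : is_opai v).

Definition opai_sup_hom : SupHom (mul_quantale R) X :=
  {| sup_fun := fun f : mul_quantale R => contract X (f : hom R Omega) v;
     sup_fun_sup := @contract_sup X R v |}.

Lemma contract_point (f : FrameHom R Omega_frame) :
  contract X f v = runit X (coprod_map (q_id X) f v).
Proof. by []. Qed.

Lemma opai_one_top : contract X (eps1 R) v = top.
Proof.
rewrite contract_point (opai_one hv) -pure_top Omega_top; apply: le_anti; first exact: top_ub.
by rewrite /runit tensor_lift_pure; apply: (le_scale (A := X)).
Qed.

(** [opai_mul] turns the action of a product of functionals into that of a [pairing] on a meet,
    which [contract_meet] splits. *)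
Definition opai_hom : QuantaleHom (mul_quantale R) X.
Proof.
refine {| q_hom := opai_sup_hom |}.
- move=> f g; rewrite [RHS]/= -[RHS]/(meet (contract X _ v) (contract X _ v)).
  rewrite -contract_meet -(opai_mul hv).
  by rewrite [RHS]contract_tensor_map.
- by rewrite (fr_two_sided X); apply: opai_one_top.
Defined.

(** The unit is already sent to the top of [X]; the other two relations are [opai_zero] and
    [opai_add] after contraction. *)
Lemma opai_hom_rel f g : @ideal_rel R f g -> opai_hom f = opai_hom g.
Proof.
case=> [||a b].
- rewrite q_hom_one (fr_two_sided X); apply: le_anti; last exact: top_ub.
  apply: le_trans (hom_mono opai_hom (top_ub one)).
  by rewrite q_hom_one (fr_two_sided X); apply: le_refl.
- rewrite hom_bot -[LHS]/(contract X (eps0 R) v) contract_point (opai_zero hv).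
  exact: hom_bot (runit X).
- rewrite !hom_join; apply: join_idr.
  rewrite -[X in X <= _]/(contract X (sup_comp (pairing a b) (mu_add R)) v).
  rewrite -contract_tensor_map; apply: le_trans (hom_mono _ (opai_add hv)) _.
  rewrite hom_join; apply/join_le; split.
  + apply: (le_trans (y := opai_hom a)); last by apply: sup_ub; left.
    rewrite [X in X <= _]contract_tensor_map; apply/contract_le => x r hxr.
    rewrite -[X in X -> _]/(pairing a b (pure r top)) pairing_pure => -[ar _].
    exact: le_contract hxr ar.
  + apply: (le_trans (y := opai_hom b)); last by apply: sup_ub; right.
    rewrite [X in X <= _]contract_tensor_map; apply/contract_le => x r hxr.
    rewrite -[X in X -> _]/(pairing a b (pure top r)) pairing_pure => -[_ br].
    exact: le_contract hxr br.
Qed.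

Lemma opai_idl_hom_idem f g :
  idem_rel f g -> cong_lift opai_hom_rel f = cong_lift opai_hom_rel g.
Proof. by case=> a; rewrite q_hom_mul; apply: fr_idem. Qed.

Definition rad_hom : FrameHom (Rad R) X := cong_lift opai_idl_hom_idem.

Lemma rad_homE W : rad_hom (rad_proj W) = contract X (W : hom R Omega) v.
Proof.
exact: eq_trans (cong_liftE opai_idl_hom_idem (idl_proj R W)) (cong_liftE opai_hom_rel W).
Qed.
End OpaiHom.
End Universal.

(** * From a homomorphism back to an OPAI *)

Section SaturatedTensor.
Variables (R : LocSemiring) (hR : overt R) (X : Frame).
Let sat2 := tensor_map (sat_hom hR) (sat_hom hR).

Lemma tensor_sat_infl (v : tensor X R) : v <= tensor_map (sup_id X) (sat_hom hR) v.
Proof.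
apply: (le_trans (y := tensor_map (sup_id X) (sup_id R) v)).
  by rewrite tensor_map_id; apply: le_refl.
by apply: tensor_map_mono => a; [apply: le_refl|apply: sat_infl].
Qed.

(** [opai_mul] puts the pullback along multiplication below the pullback along the first projection;
    the adjunction for contraction with positivity then bounds the saturation by [v]. *)
Lemma opai_sat (v : coprod X R) :
  is_opai v -> tensor_map (sup_id X) (sat_hom hR) v = v.
Proof.
move=> hv; apply: le_anti; last exact: tensor_sat_infl.
rewrite /sat_hom.
have -> : tensor_map (sup_id X) (sup_comp (contract R (pos_hom hR)) (co_op (sr_mul R))) v =
    tensor_map (sup_id X) (contract R (pos_hom hR)) (coprod_map (q_id X) (mu_mul R) v).
  by rewrite [RHS]tensor_map_compE.
rewrite (opai_mul hv).
apply: le_trans (hom_mono (tensor_map (sup_id X) (contract R (pos_hom hR)))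
  (meet_lel (A := coprod X (coprod R R)) _ _)) _.
rewrite [X in X <= _]tensor_map_compE -[X in _ <= X]/(sup_id (tensor X R) v) -tensor_map_id.
apply: tensor_map_mono => a; first exact: le_refl.
by rewrite sup_compE; apply/contract_pos_le; apply: le_refl.
Qed.

Lemma sat_top : sat_hom hR top = top.
Proof. by apply: le_anti (top_ub _) _; apply: sat_infl. Qed.

Variable v : coprod X R.
Hypothesis v_sat : tensor_map (sup_id X) (sat_hom hR) v = v.

Lemma sat2_inl : tensor_map (sup_id X) sat2 (coprod_map (q_id X) (inl R R) v) =
  coprod_map (q_id X) (inl R R) v.
Proof.
rewrite -[in RHS]v_sat [LHS]tensor_map_compE [RHS]tensor_map_compE.
congr (tensor_map _ _ v); apply: sup_hom_eq => a.
by rewrite sup_compE [LHS]tensor_map_pure sat_top.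
Qed.

Lemma sat2_inr : tensor_map (sup_id X) sat2 (coprod_map (q_id X) (inr R R) v) =
  coprod_map (q_id X) (inr R R) v.
Proof.
rewrite -[in RHS]v_sat [LHS]tensor_map_compE [RHS]tensor_map_compE.
congr (tensor_map _ _ v); apply: sup_hom_eq => a.
by rewrite sup_compE [LHS]tensor_map_pure sat_top.
Qed.

Lemma sat2_mul : tensor_map (sup_id X) sat2 (coprod_map (q_id X) (mu_mul R) v) <=
  coprod_map (q_id X) (mu_mul R) v.
Proof.
rewrite -v_sat [X in _ <= X]tensor_map_compE.
apply: le_trans (le_eq (f_equal _ (tensor_map_compE _ _ _ _ _))) _.
rewrite tensor_map_compE; apply: tensor_map_mono => a; first exact: le_refl.
by apply: sat_mul; apply: sat_saturated.
Qed.

Lemma sat2_infl (z : tensor X (tensor R R)) : z <= tensor_map (sup_id X) sat2 z.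
Proof.
apply: (le_trans (y := tensor_map (sup_id X) (tensor_map (sup_id R) (sup_id R)) z)).
  by rewrite !tensor_map_id; apply: le_refl.
apply: tensor_map_mono => d; first exact: le_refl.
by apply: tensor_map_mono => a; apply: sat_infl.
Qed.

Hypothesis dR : dualisable (SR R).

(** The axioms at zero and one live in $X\otimes\Omega\cong X$ and are read off from [k]. The other
    two are tested on functionals [pairing f g], which is enough because each right-hand side
    absorbs [sat2]. *)
Lemma is_opai_of_hom (k : QuantaleHom (mul_quantale R) X) :
  (forall f, contract X (f : hom R Omega) v = k f) ->
  k (wc_zero R) = bot ->
  (forall f g, k (join (wc_add f g) (join f g)) = k (join f g)) ->
  is_opai v.
Proof.
move=> hk k0 kadd.
have hpt : forall e : FrameHom R Omega_frame,
    coprod_map (q_id X) e v = pure (k (e : hom R Omega)) (True : Omega).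
  by move=> e; rewrite -hk contract_point runit_top.
have sep : forall z w, tensor_map (sup_id X) sat2 w <= w ->
    (forall f g, contract X (pairing f g) z <= contract X (pairing f g) w) -> z <= w.
  move=> z w hw h; apply: le_trans hw; apply: le_trans (@sat2_infl z) _.
  apply: pairing_separates => //.
have k_conv : forall f g : mul_quantale R,
    contract X (pairing f g) (coprod_map (q_id X) (mu_mul R) v) = meet (k f) (k g).
  by move=> f g; rewrite [LHS]contract_tensor_map [LHS](hk (mul f g)) q_hom_mul.
have k_meet : forall f g : mul_quantale R,
    contract X (pairing f g) (meet (coprod_map (q_id X) (inl R R) v)
      (coprod_map (q_id X) (inr R R) v)) = meet (k f) (k g).
  by move=> f g; rewrite contract_meet !hk.
split.
- by rewrite hpt k0; apply: (hom_bot (pure_r X (True : Omega))).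
- have -> : coprod_map (q_id X) (eps1 R) v = pure (k one) (True : Omega) by apply: hpt.
  by rewrite q_hom_one (fr_two_sided X) -Omega_top; apply: pure_top.
- apply: sep => [|f g].
    rewrite [X in X <= _]hom_join [tensor_map _ _ _ as X in join X _]sat2_inl.
    by rewrite sat2_inr; apply: le_refl.
  rewrite [X in X <= _]contract_tensor_map; apply/contract_le => x a hxa hfg.
  (* If [f + g] holds somewhere, then [f] and [g] both hold at [top]; this lets [pairing f g] accept
     [pure b top] and [pure top b] below. *)
  have [ftop gtop] : f top /\ g top.
    move: (proj1 (Delta_map f g (mu_add R a)) hfg) => [r [r' [_ [fr gr']]]].
    by split; [apply: (hom_mono f (top_ub r) fr)|apply: (hom_mono g (top_ub r') gr')].
  apply: le_trans (le_contract (f := wc_add f g) hxa hfg) _; rewrite (hk (wc_add f g)).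
  apply: (@le_trans X _ (k (join (f : mul_quantale R) g)) _).
    by rewrite -kadd; apply: (hom_mono k); apply: sup_ub; left.
  rewrite hom_join hom_join -!hk; apply/join_le.
  split; apply/contract_le => y b hyb hb.
  + apply: (le_trans (y := contract X (pairing f g) (coprod_map (q_id X) (inl R R) v))).
      apply: (le_contract (a := pure b top)); last by rewrite pairing_pure.
      apply: le_trans (hom_mono _ hyb); rewrite [X in _ <= X]tensor_map_pure.
      exact: le_refl.
    by apply: sup_ub; left.
  + apply: (le_trans (y := contract X (pairing f g) (coprod_map (q_id X) (inr R R) v))).
      apply: (le_contract (a := pure top b)); last by rewrite pairing_pure.
      apply: le_trans (hom_mono _ hyb); rewrite [X in _ <= X]tensor_map_pure.
      exact: le_refl.
    by apply: sup_ub; right.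
- apply: le_anti.
  + apply: sep => [|f g]; last by rewrite k_conv k_meet; apply: le_refl.
    apply: (proj2 (meet_glb (A := coprod X (coprod R R)) _ _ _)); split.
    * rewrite -[X in _ <= X]sat2_inl; apply: (hom_mono (tensor_map _ _)).
      exact: (meet_lel (A := coprod X (coprod R R))).
    * rewrite -[X in _ <= X]sat2_inr; apply: (hom_mono (tensor_map _ _)).
      exact: (meet_ler (A := coprod X (coprod R R))).
  + apply: sep => [|f g]; first exact: sat2_mul.
    by rewrite k_conv k_meet; apply: le_refl.
Qed.
End SaturatedTensor.

(** * The universal element and representability *)

Section Representation.
Variables (R : LocSemiring) (hR : overt R) (dR : dualisable (SR R)).

Definition generic_opai : coprod (Rad R) R :=
  tensor_map (sup_comp (Idl_to_Rad R) (MR_to_Idl R)) (kappa R) (dual_unit R).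

(** The second triangle identity expands the monoid ideal generated by [f], whose values on
    saturated opens are those of [f]. *)
Lemma contract_dual_unit (f : mul_quantale R) :
  contract (MR R) (sup_comp (f : hom R Omega) (kappa R)) (dual_unit R) =
  nuc_proj (monoid_ideal_nucleus R) f.
Proof.
have /duality_pure [_ h2] := duality_unitP hR dR.
apply: le_char => c; rewrite contract_le h2 duality_unit_True.
have e : forall b : SR R, eval R (pure b (nuc_proj (monoid_ideal_nucleus R) f)) =
    (f : hom R Omega) (kappa R b).
  move=> b; rewrite /eval tensor_lift_pure.
  rewrite -[LHS]/((mul f top : hom R Omega) (kappa R b)) (conv_top hR).
  by rewrite (sat_fix hR (proj2_sig b)).
by split=> h a b hab; move: (h a b hab); rewrite e.
Qed.

Lemma contract_generic_opai (f : mul_quantale R) :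
  contract (Rad R) (f : hom R Omega) generic_opai = rad_proj R f.
Proof.
rewrite /generic_opai contract_natural contract_dual_unit.
exact: (f_equal (Idl_to_Rad R) (idl_proj_nucleus f)).
Qed.

Lemma generic_opai_sat :
  tensor_map (sup_id (Rad R)) (sat_hom hR) generic_opai = generic_opai.
Proof.
rewrite /generic_opai tensor_map_compE; congr (tensor_map _ _ _).
by apply: sup_hom_eq => s; apply: sat_fix; apply: (proj2_sig s).
Qed.

Lemma generic_opaiP : is_opai generic_opai.
Proof.
apply: (is_opai_of_hom generic_opai_sat dR contract_generic_opai).
- exact: rad_proj_zero.
- exact: rad_proj_add.
Qed.

(** Both opens are fixed by saturation in the [R] variable and act identically on functionals, so
    [contract_separates] identifies them. *)
Lemma rad_hom_generic (X : Frame) (v : coprod X R) (hv : is_opai v) :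
  coprod_map (rad_hom hv) (q_id R) generic_opai = v.
Proof.
set w := coprod_map _ _ _.
have w_sat : tensor_map (sup_id X) (sat_hom hR) w = w.
  rewrite /w -[in RHS]generic_opai_sat [LHS]tensor_map_compE [RHS]tensor_map_compE.
  by congr (tensor_map _ _ _); apply: sup_hom_eq.
have e : forall f, contract X f w = contract X f v.
  move=> f; rewrite [LHS]contract_natural.
  have -> : sup_comp f (sup_id R) = f by apply: sup_hom_eq.
  by rewrite contract_generic_opai rad_homE.
rewrite -w_sat -(opai_sat hR hv).
by apply: le_anti; apply: contract_separates => // f; rewrite e; apply: le_refl.
Qed.

(** The action of the pulled-back element is [k] after [rad_proj], and [rad_proj] is surjective. *)
Lemma rad_hom_unique (X : Frame) (k : FrameHom (Rad R) X)
  (h : is_opai (coprod_map k (q_id R) generic_opai)) : rad_hom h = k.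
Proof.
apply: rad_hom_eq => W; rewrite rad_homE [LHS]contract_natural.
have -> : sup_comp (W : hom R Omega) (sup_id R) = W by apply: sup_hom_eq.
by rewrite contract_generic_opai.
Qed.

Definition opai_iso : NatIso (yoneda (Rad R)) (OPAI R).
Proof.
pose u : OPAI R (Rad R) := exist _ generic_opai generic_opaiP.
refine {| iso_fun := fun X (k : yoneda (Rad R) X) => psh_map k u;
          iso_inv := fun X (v : OPAI R X) => rad_hom (proj2_sig v) : yoneda (Rad R) X |}.
- by move=> Y X f k; apply: psh_map_comp.
- by move=> X k; apply: rad_hom_unique.
- by move=> X v; apply: sig_ext; apply: rad_hom_generic.
Defined.
End Representation.

Theorem corollary4p4 (R : LocSemiring)
  (R_overt : overt R) (SR_dualisable : dualisable (SR R)) :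
  exists eta : SupHom Omega (tensor (MR R) (SR R)),
    unique (is_duality (eval R)) eta /\
    exists u : OPAI R (Rad R),
      proj1_sig u =
        tensor_map (sup_comp (Idl_to_Rad R) (MR_to_Idl R)) (kappa R) (eta (top : Omega)) /\
      represented_by u.
Proof.
exists (duality_unit R); split.
  split=> [|eta]; first exact: duality_unitP.
  exact: duality_unique (duality_unitP R_overt SR_dualisable).
exists (exist _ (generic_opai R) (generic_opaiP R_overt SR_dualisable) : OPAI R (Rad R)); split.
  by rewrite Omega_top duality_unit_True.
by exists (opai_iso R_overt SR_dualisable); apply: psh_map_id.
Qed.
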